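(* Under the same conditions as in the asymptotic normality result for $(\hat A,\hat C,\hat B)$ (model correctly specified, $\boldsymbol\Sigma$ known, $Z^\top Z/n\to q>0$), let $\hat C'=Z^\top R/(Z^\top Z)$ and $$\hat C=\frac{M^\top M\,Z^\top R-Z^\top M\,M^\top R}{Z^\top Z\,M^\top M-(Z^\top M)^2}+\frac{\delta\sigma_2\,Z^\top M}{\sigma_1\,Z^\top Z}.$$ Then $$\sqrt n\left(\begin{pmatrix}\hat C'\\ \hat C\end{pmatrix}-\begin{pmatrix}C+AB\\ C\end{pmatrix}\right)\xrightarrow{\mathcal D}\mathcal N(\mathbf 0,\boldsymbol V'),$$ where $$\boldsymbol V'=\begin{pmatrix}(B^2\sigma_1^2+2B\delta\sigma_1\sigma_2+\sigma_2^2)/q & (\sigma_2^2+B\delta\sigma_1\sigma_2)/q\\ (\sigma_2^2+B\delta\sigma_1\sigma_2)/q & \sigma_2^2(qA^2+\sigma_1^2-qA^2\delta^2)/(q\sigma_1^2)\end{pmatrix}.$$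
   Context: Single-level mediation model: $Z\in\mathbb{R}^n$ is a (fixed, observed) treatment-assignment vector; $M\in\mathbb{R}^n$ (mediator) and $R\in\mathbb{R}^n$ (outcome) are observed vectors satisfying $$M=ZA+E_1,\qquad R=ZC+MB+E_2,$$ with unknown scalar coefficients $A,B,C$. The errors satisfy $\operatorname{vec}(E_1\ E_2)\sim\mathcal{N}(\mathbf 0,\boldsymbol{\Sigma}\otimes I_n)$ with $\boldsymbol{\Sigma}=\begin{pmatrix}\sigma_1^2&\delta\sigma_1\sigma_2\\ \delta\sigma_1\sigma_2&\sigma_2^2\end{pmatrix}$, $\sigma_1,\sigma_2>0$, $\delta\in(-1,1)$; i.e. the $n$ pairs $(E_{1,j},E_{2,j})$ are i.i.d. bivariate normal with mean zero and covariance $\boldsymbol{\Sigma}$, independent of $Z$. The total effect is $C'=C+AB$. *)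

(* Defs.v *)
From HB Require Import structures.
From mathcomp Require Import all_boot all_order all_algebra.
From mathcomp Require Import all_classical all_reals all_analysis.
Set Implicit Arguments. Unset Strict Implicit. Unset Printing Implicit Defensive.
Import Order.TTheory GRing.Theory Num.Theory.
Import numFieldNormedType.Exports.
Local Open Scope classical_set_scope.
Local Open Scope ring_scope.

Definition gauss1 {R : realType} (v : R) : set R -> \bar R :=
  if v == 0 then \d_(0 : R) else normal_prob 0 (Num.sqrt v).

Definition qform2 {R : realType} (v11 v12 v22 t1 t2 : R) : R :=
  t1 ^+ 2 * v11 + 2 * t1 * t2 * v12 + t2 ^+ 2 * v22.

(** [is_gauss2 mu v11 v12 v22]: the (probability) law [mu] on R x R is the
    centered bivariate normal law N(0, V), V = [[v11, v12], [v12, v22]],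
    defined (Cramer-Wold) by: every linear functional t.z has law
    N(0, t^T V t).  This covers singular V as well. *)
Definition is_gauss2 {R : realType} (mu : set (R * R) -> \bar R)
  (v11 v12 v22 : R) : Prop :=
  forall t1 t2 : R, forall A : set R, measurable A ->
    mu ((fun z : R * R => t1 * z.1 + t2 * z.2) @^-1` A)
    = gauss1 (qform2 v11 v12 v22 t1 t2) A.

Definition iid_bvn {R : realType} {d} {T : measurableType d}
  (P : probability T R) (n : nat) (X Y : 'I_n -> T -> R)
  (s1 s2 dl : R) : Prop :=
  (forall i, measurable_fun setT (X i) /\ measurable_fun setT (Y i)) /\
  (forall i, is_gauss2 (fun S => P ((fun w => (X i w, Y i w)) @^-1` S))
                       (s1 ^+ 2) (dl * s1 * s2) (s2 ^+ 2)) /\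
  (forall B : 'I_n -> set (R * R), (forall i, measurable (B i)) ->
     P (\bigcap_(i in [set: 'I_n]) ((fun w => (X i w, Y i w)) @^-1` B i))
     = (\prod_(i < n) P ((fun w => (X i w, Y i w)) @^-1` B i))%E).

Definition cvg_distr {R : realType} {d} {T : measurableType d}
  (P : probability T R) (Xn : nat -> T -> R * R)
  (mu : probability (R * R)%type R) : Prop :=
  forall f : R * R -> R, continuous f -> (exists M : R, forall z, `|f z| <= M) ->
    (fun n => \int[P]_w (f (Xn n w))%:E)%E @ \oo --> (\int[mu]_z (f z)%:E)%E.

Definition dotv {R : realType} (n : nat) (u v : 'I_n -> R) : R :=
  \sum_(i < n) u i * v i.

(* Main.v *)
(** Write [E2 = rho E1 + W] with [rho = dl s2 / s1]; since each pair of errors is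
    bivariate normal, [W] is independent of [E1].  Both estimation errors are
    affine in [W] with coefficients depending on [E1] only, so conditionally on
    [E1] every linear combination of them is exactly normal, and its conditional
    characteristic function is an explicit continuous function of
    [Z.Z / n -> q], [Z.E1 / n -> 0] and [E1.E1 / n -> s1^2].  Hence the
    characteristic functions converge, and Levy's continuity theorem in the plane,
    proved by Gaussian smoothing, gives convergence in distribution; no central limit
    theorem is needed. *)

Require Import Defs.
From HB Require Import structures.
From mathcomp Require Import all_boot all_order all_algebra.
From mathcomp Require Import all_classical all_reals all_analysis.
From mathcomp Require Import measurable_realfun ring lra.
Set Implicit Arguments. Unset Strict Implicit. Unset Printing Implicit Defensive.
Import Order.TTheory GRing.Theory Num.Theory.
Import numFieldNormedType.Exports.
Local Open Scope classical_set_scope.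
Local Open Scope ring_scope.

(** * Bounded measurable functions under probability laws: integrals, Fubini, bounded convergence *)

Section BoundedMeasurable.
Context {R : realType}.

(** Complex numbers are avoided: cos (a x + b y + c) with a free phase [c] carries the real part (c
    = 0) and the imaginary part (c = - pi / 2) of a characteristic function. The phase also makes
    inductions and conditioning close, since variables already fixed are absorbed into it. The
    obstacle is the event on which the design of the regression on [(Z, M)] is singular (everything
    when n = 1): there the estimator takes the value given by division by 0 and is no longer affine
    in the residuals. Convergence in probability of the averages is therefore encoded by one bounded
    function [dev], whose small expectation makes that event negligible by a Markov bound. The
    continuity theorem in the plane is used three times: on a constant sequence, to turn factorised
    characteristic functions into independence; to get [Z.E1 / n -> 0] in probability; and for the
    final limit. Outside the density computations for the normal law, integrands are bounded and
    measurable and measures are probabilities, so that integrability is automatic and integrals can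
    be real numbers. *)

Definition bmeas {d} {T : measurableType d} (f : T -> R) : Prop :=
  measurable_fun setT f /\ exists M, forall x, `|f x| <= M.

Section One.
Context {d} {T : measurableType d}.
Implicit Types f g : T -> R.

Lemma bmeas_cst (c : R) : bmeas (fun _ : T => c).
Proof. by split; [exact: measurable_cst|exists `|c|]. Qed.

Lemma bmeasD f g : bmeas f -> bmeas g -> bmeas (fun x => f x + g x).
Proof.
move=> [mf [M fM]] [mg [N gN]]; split; first exact: measurable_funD.
by exists (M + N) => x; rewrite (le_trans (ler_normD _ _))// lerD.
Qed.

Lemma bmeasM f g : bmeas f -> bmeas g -> bmeas (fun x => f x * g x).
Proof.
move=> [mf [M fM]] [mg [N gN]]; split; first exact: measurable_funM.
by exists (M * N) => x; rewrite normrM ler_pM.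
Qed.

Lemma bmeasN f : bmeas f -> bmeas (fun x => - f x).
Proof.
move=> [mf [M fM]]; split; first exact: measurableT_comp.
by exists M => x; rewrite normrN.
Qed.

Lemma bmeasB f g : bmeas f -> bmeas g -> bmeas (fun x => f x - g x).
Proof. by move=> bf bg; exact: bmeasD bf (bmeasN bg). Qed.

Lemma bmeas_norm f : bmeas f -> bmeas (fun x => `|f x|).
Proof.
move=> [mf [M fM]]; split; first exact: measurableT_comp.
by exists M => x; rewrite normr_id.
Qed.

Lemma measurable_cosR : measurable_fun setT (@cos R).
Proof. by apply: continuous_measurable_fun; exact: continuous_cos. Qed.

Lemma bmeas_cos f : measurable_fun setT f -> bmeas (fun x => cos (f x)).
Proof.
move=> mf; split; first exact: measurableT_comp measurable_cosR mf.
by exists 1 => x; exact: cos_max.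
Qed.

Lemma bmeas_expRN f : measurable_fun setT f -> (forall x, 0 <= f x) ->
  bmeas (fun x => expR (- f x)).
Proof.
move=> mf f0; split.
  by apply: measurableT_comp => //; exact: measurableT_comp.
by exists 1 => x; rewrite ger0_norm ?expR_ge0// -[leRHS]expR0 ler_expR oppr_le0.
Qed.

Lemma bmeas_comp {d'} {T' : measurableType d'} (h : T' -> T) f :
  measurable_fun setT h -> bmeas f -> bmeas (fun x => f (h x)).
Proof.
by move=> mh [mf [M fM]]; split; [exact: measurableT_comp mf mh|exists M].
Qed.

(** The estimators divide by random determinants, so zeros must be covered: [y^-1] is [y] times the
    inverse of [y ^+ 2] also at 0, where both are 0, and the inverse of a nonnegative number is a
    real power, known to be measurable. *)
Lemma measurable_funV f :
  measurable_fun setT f -> measurable_fun setT (fun x => (f x)^-1).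
Proof.
move=> mf.
have -> : (fun x => (f x)^-1) = (fun x => f x * ((f x ^+ 2) `^ (- 1))).
  apply/funext => x; rewrite powR_inv1 ?sqr_ge0//.
  have [->|fx] := eqVneq (f x) 0; first by rewrite invr0 mul0r.
  by rewrite expr2 invfM mulrA divff// mul1r.
apply: measurable_funM => //.
apply: (measurableT_comp (f := fun y : R => y `^ (- 1))).
  exact: measurable_powR.
exact: measurable_funX.
Qed.

Lemma measurable_funZ (c : R) f :
  measurable_fun setT f -> measurable_fun setT (fun x => c * f x).
Proof. by move=> mf; apply: measurable_funM => //; exact: measurable_cst. Qed.

Variable P : probability T R.

Lemma bmeas_integrable f : bmeas f -> P.-integrable setT (EFin \o f).
Proof.
move=> [mf [M fM]]; apply: measurable_bounded_integrable => //.
  by rewrite (le_lt_trans (probability_le1 P _))// ltry.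
exists M; split; first exact: num_real.
by move=> x Mx y _ /=; rewrite (le_trans (fM y))// ltW.
Qed.

Lemma EFin_RintE f : bmeas f ->
  (\int[P]_x (f x)%:E)%E = (\int[P]_x f x)%:E.
Proof.
move=> bf; rewrite /Rintegral fineK//.
by apply: integrable_fin_num => //; exact: bmeas_integrable.
Qed.

Lemma RintE_cst (c : R) : \int[P]_x c = c.
Proof. by rewrite Rintegral_cst// [X in fine X](probability_setT P) mulr1. Qed.

Lemma RintE_D f g : bmeas f -> bmeas g ->
  \int[P]_x (f x + g x) = \int[P]_x f x + \int[P]_x g x.
Proof. by move=> bf bg; rewrite RintegralD//; exact: bmeas_integrable. Qed.

Lemma RintE_B f g : bmeas f -> bmeas g ->
  \int[P]_x (f x - g x) = \int[P]_x f x - \int[P]_x g x.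
Proof. by move=> bf bg; rewrite RintegralB//; exact: bmeas_integrable. Qed.

Lemma RintE_Z (c : R) f : bmeas f -> \int[P]_x (c * f x) = c * \int[P]_x f x.
Proof. by move=> bf; rewrite RintegralZl//; exact: bmeas_integrable. Qed.

Lemma RintE_le f g : bmeas f -> bmeas g -> (forall x, f x <= g x) ->
  \int[P]_x f x <= \int[P]_x g x.
Proof. by move=> bf bg fg; apply: le_Rintegral => //; exact: bmeas_integrable. Qed.

Lemma RintE_dist_le f g h : bmeas f -> bmeas g -> bmeas h ->
  (forall x, `|f x - g x| <= h x) ->
  `|\int[P]_x f x - \int[P]_x g x| <= \int[P]_x h x.
Proof.
move=> bf bg bh fgh; rewrite -RintE_B//.
apply: (le_trans (le_normr_Rintegral _ _)) => //.
  exact/bmeas_integrable/bmeasB.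
by apply: RintE_le => //; exact/bmeas_norm/bmeasB.
Qed.

Lemma RintE_norm_le f (M : R) : bmeas f -> (forall x, `|f x| <= M) ->
  `|\int[P]_x f x| <= M.
Proof.
move=> bf fM; rewrite -[leRHS](RintE_cst M) -[X in `|X|]subr0 -(RintE_cst 0).
apply: RintE_dist_le => // [||x]; [exact: bmeas_cst..|by rewrite subr0].
Qed.

(** Bounded convergence: the constant [M] dominates, and the limit inherits measurability and the
    bound from pointwise convergence. *)
Lemma RintE_cvg (f_ : nat -> T -> R) f (M : R) :
  (forall n, measurable_fun setT (f_ n)) -> (forall n x, `|f_ n x| <= M) ->
  (forall x, f_ n x @[n --> \oo] --> f x) ->
  \int[P]_x f_ n x @[n --> \oo] --> \int[P]_x f x.
Proof.
move=> mf fM ff.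
have mf' : measurable_fun setT f by apply: measurable_fun_cvg mf _ => x _; exact: ff.
have bf : bmeas f.
  split=> //; exists M => x.
  rewrite -(cvg_lim (@Rhausdorff R) (cvg_norm (ff x))).
  apply: limr_le; first by apply/cvg_ex; eexists; exact: cvg_norm (ff x).
  by apply: nearW => n; exact: fM.
suff : (\int[P]_x (f_ n x)%:E)%E @[n --> \oo] --> (\int[P]_x f x)%:E.
  exact: fine_cvg.
rewrite -EFin_RintE//.
apply: (@dominated_cvg _ T R P setT measurableT (fun n x => (f_ n x)%:E)
  (fun x => (f x)%:E) (fun _ => M%:E)).
- by move=> n; exact/measurable_EFinP.
- by move=> x _; apply: cvg_EFin; [exact: nearW|exact: ff].
- by [].
- exact: (bmeas_integrable (bmeas_cst M)).
- by move=> n x _; rewrite lee_fin.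
Qed.

End One.

Section Two.
Context {d1 d2} {T1 : measurableType d1} {T2 : measurableType d2}.
Variables (P : probability T1 R) (Q : probability T2 R).
Implicit Types f : T1 * T2 -> R.

Lemma bmeas_pair1 f x : bmeas f -> bmeas (fun y => f (x, y)).
Proof. by apply: bmeas_comp; exact: measurable_pair1. Qed.

Lemma bmeas_pair2 f y : bmeas f -> bmeas (fun x => f (x, y)).
Proof. by apply: bmeas_comp; exact: measurable_pair2. Qed.

Lemma bmeas_Rint f : bmeas f -> bmeas (fun x => \int[Q]_y f (x, y)).
Proof.
move=> bf; have [mf [M fM]] := bf; split.
  apply/measurable_EFinP.
  have := measurable_fubini_F (bmeas_integrable (P \x Q)%E bf).
  apply: eq_measurable_fun => x _ /=.
  by rewrite /fubini_F /= (EFin_RintE Q (bmeas_pair1 x bf)).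
by exists M => x; apply: RintE_norm_le => //; exact: bmeas_pair1.
Qed.

Lemma RintE_prod f : bmeas f ->
  \int[(P \x Q)%E]_z f z = \int[P]_x \int[Q]_y f (x, y).
Proof.
move=> bf; apply: EFin_inj; rewrite -!EFin_RintE//; last exact: bmeas_Rint.
rewrite -(integral12_prod_meas1 (bmeas_integrable (P \x Q)%E bf)).
by apply: eq_integral => x _; rewrite -EFin_RintE//; exact: bmeas_pair1.
Qed.

Lemma RintE_prod2 f : bmeas f ->
  \int[(P \x Q)%E]_z f z = \int[Q]_y \int[P]_x f (x, y).
Proof.
move=> bf; have bf' : bmeas (fun y => \int[P]_x f (x, y)).
  have [mf [M fM]] := bf; split.
    apply/measurable_EFinP.
    have := measurable_fubini_G (bmeas_integrable (P \x Q)%E bf).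
    apply: eq_measurable_fun => x _ /=.
    by rewrite /fubini_G /= (EFin_RintE P (bmeas_pair2 x bf)).
  by exists M => x; apply: RintE_norm_le => //; exact: bmeas_pair2.
apply: EFin_inj; rewrite -!EFin_RintE//.
rewrite -(integral21_prod_meas1 (bmeas_integrable (P \x Q)%E bf)).
by apply: eq_integral => x _; rewrite -EFin_RintE//; exact: bmeas_pair2.
Qed.

Lemma RintE_swap f : bmeas f ->
  \int[P]_x \int[Q]_y f (x, y) = \int[Q]_y \int[P]_x f (x, y).
Proof. by move=> bf; rewrite -RintE_prod// RintE_prod2. Qed.

End Two.

Lemma eq_RintE {d} {T : measurableType d} (P Q : {measure set T -> \bar R})
    (f : T -> R) :
  (forall A, measurable A -> P A = Q A) -> \int[P]_x f x = \int[Q]_x f x.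
Proof.
by move=> PQ; congr fine; apply: eq_measure_integral => A mA _; exact: PQ.
Qed.

End BoundedMeasurable.

(** * Normal integrals through the density; Laplace transform of the squared deviation *)

Section Normal.
Context {R : realType}.
Local Notation mu := (@lebesgue_measure R).

Lemma integrable_bmeas_normal_pdf (m s : R) (h : R -> R) : bmeas h ->
  mu.-integrable setT (fun x => (h x * normal_pdf m s x)%:E).
Proof.
move=> [mh [M hM]].
have : mu.-integrable setT (fun x => (M%:E * (normal_pdf m s x)%:E)%E).
  by apply: integrableZl => //; exact: integrable_normal_pdf.
apply: le_integrable => //.
  apply/measurable_EFinP; apply: measurable_funM => //.
  exact: measurable_normal_pdf.
move=> x _ /=; rewrite lee_fin !normrM ler_wpM2r// (le_trans (hM x))//.
exact: ler_norm.
Qed.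

(** The change of variables involves the Radon-Nikodym derivative, determined only almost
    everywhere; it agrees with [normal_pdf] because both have the same integral over every
    measurable set. *)
Lemma Rintegral_normal_prob (m s : R) (h : R -> R) : bmeas h ->
  \int[normal_prob m s]_x h x = \int[mu]_x (h x * normal_pdf m s x).
Proof.
move=> bh; congr fine; have [mh _] := bh.
have dom := normal_prob_dominates m s.
have mhp : measurable_fun setT (fun x : R => (h x * normal_pdf m s x)%:E).
  apply/measurable_EFinP; apply: measurable_funM => //.
  exact: measurable_normal_pdf.
rewrite -(Radon_Nikodym_change_of_variables dom)//=; last exact: bmeas_integrable.
apply: ae_eq_integral => //.
- apply: emeasurable_funM; first exact/measurable_EFinP.
  apply: (measurable_int mu).
  apply: (integrableS _ _ (@subsetT _ _)) => //=.
  by apply: Radon_Nikodym_integrable; exact: dom.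
- rewrite [X in ae_eq _ _ _ X](_ : _ = (fun x : R =>
    ((h x)%:E * (normal_pdf m s x)%:E)%E))//.
  apply: ae_eqe_mul2l => /=.
  rewrite Radon_NikodymE/=.
  case: cid => /= k [k1 k2 k3].
  apply: integral_ae_eq => //=.
  + by apply/measurableT_comp =>//; exact: measurable_normal_pdf.
  + by move=> E E01 mE; rewrite -k3.
Qed.

(** With k = 1 + 2 l s^2, the factor exp (- l (x - m)^2) turns the density of N(m, s^2) into 1 /
    sqrt k times the density of N(m, s^2 / k), which has integral 1. *)
Lemma normal_laplace (m s l : R) : 0 < s -> 0 <= l ->
  \int[normal_prob m s]_x expR (- (l * (x - m) ^+ 2)) =
  (Num.sqrt (1 + 2 * l * s ^+ 2))^-1.
Proof.
move=> s0 l0.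
have mX : measurable_fun setT (fun x : R => l * (x - m) ^+ 2).
  apply: measurable_funZ; apply: measurable_funX.
  by apply: measurable_funB => //; exact: measurable_cst.
rewrite Rintegral_normal_prob; last first.
  by apply: bmeas_expRN => // x; rewrite mulr_ge0// sqr_ge0.
set k := 1 + 2 * l * s ^+ 2.
have k0 : 0 < k by rewrite ltr_pwDl// mulr_ge0 ?sqr_ge0// mulr_ge0.
have rk0 : 0 < Num.sqrt k by rewrite sqrtr_gt0.
pose t := s / Num.sqrt k.
have t0 : 0 < t by rewrite divr_gt0.
transitivity (\int[mu]_x ((Num.sqrt k)^-1 * normal_pdf m t x)).
  apply: eq_Rintegral => x _.
  rewrite !normal_pdfE ?gt_eqF// /normal_peak /normal_fun.
  rewrite [LHS]mulrCA -expRD [RHS]mulrA; congr (_ * expR _).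
    have -> : s ^+ 2 * pi *+ 2 = k * (t ^+ 2 * pi *+ 2).
      rewrite /t expr_div_n sqr_sqrtr ?(ltW k0)// -!(mulr_natr (_ * pi)); field.
      by rewrite gt_eqF.
    by rewrite sqrtrM ?(ltW k0)// invfM.
  rewrite /t expr_div_n sqr_sqrtr ?(ltW k0)// -!(mulr_natr (_ ^+ 2)).
  rewrite -(mulr_natr (_ / _)) /k; field.
  by rewrite -/k !gt_eqF.
rewrite RintegralZl//; last exact: integrable_normal_pdf.
by rewrite /Rintegral integral_normal_pdf mulr1.
Qed.
End Normal.

(** * Characteristic function of the normal law *)

Section NormalCf.
Context {R : realType}.
Local Notation mu := (@lebesgue_measure R).

Lemma is_derive_affine (b a x : R) : is_derive x 1 (fun x : R => b * x + a) b.
Proof. by apply: is_derive_eq; rewrite /GRing.scale /=; ring. Qed.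

Lemma is_derive_sin_affine (b a x : R) :
  is_derive x 1 (fun x : R => sin (b * x + a)) (b * cos (b * x + a)).
Proof.
have H := is_derive_affine b a x.
apply: (is_derive_eq (@is_derive1_comp R sin (fun x : R => b * x + a) x _ _ _ H)).
by rewrite mulrC.
Qed.

Lemma is_derive_cos_affine (b a x : R) :
  is_derive x 1 (fun x : R => cos (b * x + a)) (- (b * sin (b * x + a))).
Proof.
have H := is_derive_affine b a x.
apply: (is_derive_eq (@is_derive1_comp R cos (fun x : R => b * x + a) x _ _ _ H)).
by rewrite mulNr mulrC.
Qed.

Lemma is_derive_expR_sqr (k x : R) :
  is_derive x 1 (fun x : R => expR (- (k * x ^+ 2)))
    (- (2 * k * x * expR (- (k * x ^+ 2)))).
Proof.
have H : is_derive x 1 (fun x : R => - (k * x ^+ 2)) (- (2 * k * x)).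
  by apply: is_derive_eq; rewrite /GRing.scale /=; ring.
apply: (is_derive_eq (@is_derive1_comp R expR (fun x : R => - (k * x ^+ 2)) x _ _ _ H)).
by ring.
Qed.

Lemma normal_pdf0E (s : R) : s != 0 ->
  normal_pdf 0 s = (fun x => normal_peak s * expR (- ((s ^+ 2 *+ 2)^-1 * x ^+ 2))).
Proof.
move=> s0; apply/funext => x; rewrite normal_pdfE// /normal_fun subr0.
by rewrite mulNr mulrC [in RHS]mulrC (mulrC (_ ^-1)).
Qed.

Lemma is_derive_normal_pdf (s x : R) : s != 0 ->
  is_derive x 1 (normal_pdf 0 s) (- (x / s ^+ 2 * normal_pdf 0 s x)).
Proof.
move=> s0; rewrite normal_pdf0E//.
have H := is_derive_expR_sqr (s ^+ 2 *+ 2)^-1 x.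
by apply: is_derive_eq; rewrite /GRing.scale /= -mulr_natr; field.
Qed.

Lemma integrable_norm_normal_pdf (s : R) : 0 < s ->
  mu.-integrable setT (fun x => (`|x| * normal_pdf 0 s x)%:E).
Proof.
move=> s0; have sn0 : s != 0 by rewrite gt_eqF.
have s2 : 2 * s != 0 by rewrite mulf_neq0.
(* Doubling the standard deviation leaves a spare factor exp (- u) with u = 3 x^2 / (8 s^2) = x^2 /
   c. It absorbs |x| <= 1 + x^2 = 1 + c u, because exp u is at least 1 and at least u. *)
pose c := 8 * s ^+ 2 / 3.
have c0 : 0 <= c by rewrite divr_ge0// mulr_ge0// sqr_ge0.
pose C := normal_peak s / normal_peak (2 * s) * (1 + c).
have : mu.-integrable setT (fun x => (C%:E * (normal_pdf 0 (2 * s) x)%:E)%E).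
  by apply: integrableZl => //; exact: integrable_normal_pdf.
apply: le_integrable => //.
  apply/measurable_EFinP; apply: measurable_funM => //.
  exact: measurable_normal_pdf.
move=> x _ /=; rewrite lee_fin normrM normr_id.
rewrite [leRHS]ger0_norm; last first.
  by rewrite !mulr_ge0 ?normal_pdf_ge0 ?normal_peak_ge0 ?invr_ge0 ?normal_peak_ge0// addr_ge0.
rewrite ger0_norm ?normal_pdf_ge0//.
rewrite /C !normal_pdf0E// [leRHS](_ : _ = normal_peak s * ((1 + c) *
  expR (- (((2 * s) ^+ 2 *+ 2)^-1 * x ^+ 2)))); last first.
  by field; rewrite gt_eqF// normal_peak_gt0.
rewrite mulrCA ler_wpM2l ?normal_peak_ge0//.
pose u := 3 * x ^+ 2 / (8 * s ^+ 2).
have u0 : 0 <= u by apply: divr_ge0; apply: mulr_ge0 => //; exact: sqr_ge0.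
have -> : - ((s ^+ 2 *+ 2)^-1 * x ^+ 2) = - (((2 * s) ^+ 2 *+ 2)^-1 * x ^+ 2) - u.
  by rewrite /u -!(mulr_natr (_ ^+ 2)); field.
rewrite expRD mulrCA [leRHS]mulrC ler_wpM2l ?expR_ge0// expRN ler_pdivrMr ?expR_gt0//.
have xu : x ^+ 2 = c * u by rewrite /c /u; field.
have : `|x| <= 1 + c * u.
  rewrite -xu -real_normK ?num_real//; move: (`|x|) (normr_ge0 x) => y y0; nra.
move/le_trans; apply; rewrite mulrDl mul1r lerD//.
  by rewrite -expR0 ler_expR.
by rewrite ler_wpM2l// (le_trans _ (expR_ge1Dx u))// lerDr.
Qed.

Lemma integrable_sin_normal_pdf (s b a : R) : 0 < s ->
  mu.-integrable setT (fun x => (x * sin (b * x + a) * normal_pdf 0 s x)%:E).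
Proof.
move=> s0; have := integrable_norm_normal_pdf s0; apply: le_integrable => //.
  apply/measurable_EFinP; apply: measurable_funM => //; last exact: measurable_normal_pdf.
  apply: measurable_funM => //; apply: measurableT_comp.
    by apply: continuous_measurable_fun; exact: continuous_sin.
  by apply: measurable_funD => //; exact: measurable_funZ.
move=> x _ /=; rewrite lee_fin !normrM normr_id ler_wpM2r// ler_piMr//.
exact: sin_max.
Qed.

Lemma integrable_cos_normal_pdf (s b a : R) :
  mu.-integrable setT (fun x => (cos (b * x + a) * normal_pdf 0 s x)%:E).
Proof.
apply: integrable_bmeas_normal_pdf; apply: bmeas_cos.
by apply: measurable_funD => //; exact: measurable_funZ.
Qed.

End NormalCf.

Section NormalCfMain.
Context {R : realType}.
Local Notation mu := (@lebesgue_measure R).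

Lemma cvg_normal_pdf_pinfty (s : R) : s != 0 -> normal_pdf 0 s n%:R @[n --> \oo] --> 0.
Proof.
move=> s0; rewrite normal_pdf0E//; rewrite -[X in _ --> X](mulr0 (normal_peak s)).
apply: cvgM; first exact: cvg_cst.
have k0 : 0 < (s ^+ 2 *+ 2)^-1 by rewrite invr_gt0 pmulrn_lgt0// exprn_even_gt0.
set k := _^-1 in k0 *.
apply: (@squeeze_cvgr _ _ _ _ (cst 0) (fun n : nat => k^-1 * n%:R^-1)).
- near=> n.
  have n0 : (0 < n)%N by near: n; exact: nbhs_infty_gt.
  have nr : 1 <= n%:R :> R by rewrite ler1n.
  rewrite expR_ge0/= expRN -invfM lef_pV2 ?posrE ?expR_gt0 ?mulr_gt0//; last first.
    by rewrite ltr0n.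
  rewrite (le_trans _ (expR_ge1Dx _))// ler_wpDl// ler_wpM2l ?(ltW k0)//.
  by rewrite expr2 ler_peMl// (le_trans ler01).
- exact: cvg_cst.
- rewrite -[X in _ --> X](mulr0 k^-1); apply: cvgM; first exact: cvg_cst.
  apply/gtr0_cvgV0; last exact: cvgr_idn. near=> n; rewrite ltr0n; near: n; exact: nbhs_infty_gt.
Unshelve. all: end_near. Qed.

(** Stein's identity for sin (b x + a). The product [H] of the sine and the density has derivative
    [h]; its boundary values on [- n - 1, n + 1] vanish in the limit, hence the integral of [h] over
    the line is 0. The shift by one keeps the interval nondegenerate at n = 0. *)
Lemma integral_sin_normal_pdf (s b a : R) : 0 < s ->
  \int[mu]_x (x * sin (b * x + a) * normal_pdf 0 s x) =
  b * s ^+ 2 * \int[mu]_x (cos (b * x + a) * normal_pdf 0 s x).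
Proof.
move=> s0; have sn0 : s != 0 by rewrite gt_eqF.
pose H x := sin (b * x + a) * normal_pdf 0 s x.
pose h x := b * (cos (b * x + a) * normal_pdf 0 s x)
            - s ^- 2 * (x * sin (b * x + a) * normal_pdf 0 s x).
have dH (x : R) : is_derive x 1 H (h x).
  have Hs := is_derive_sin_affine b a x; have Hg := is_derive_normal_pdf x sn0.
  apply: (is_derive_eq (is_deriveM Hs Hg)); rewrite /GRing.scale /= /h; field.
  by rewrite sn0.
have ic := integrable_cos_normal_pdf s b a.
have is' := integrable_sin_normal_pdf b a s0.
have ih : mu.-integrable setT (EFin \o h).
  have : mu.-integrable setT (fun x => ((b%:E * (cos (b * x + a) * normal_pdf 0 s x)%:E)
    - (s ^- 2)%:E * (x * sin (b * x + a) * normal_pdf 0 s x)%:E)%E).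
    by apply: integrableB => //; exact: integrableZl.
  by apply: eq_integrable.
have ch : continuous h.
  have cg : continuous (normal_pdf 0 s) by exact: continuous_normal_pdf.
  have ca (x : R) : {for x, continuous (fun x : R => b * x + a)}.
    apply: cvgD; last exact: cvg_cst.
    by apply: cvgM; [exact: cvg_cst|exact: cvg_id].
  move=> x; apply: cvgB; apply: cvgM; try exact: cvg_cst; apply: cvgM; try exact: cg.
    apply: (@continuous_comp _ _ _ (fun x : R => b * x + a) cos); first exact: ca.
    exact: continuous_cos.
  apply: cvgM; first exact: cvg_id.
  apply: (@continuous_comp _ _ _ (fun x : R => b * x + a) sin); first exact: ca.
  exact: continuous_sin.
have mh : measurable_fun setT (fun x : R => (h x)%:E).
  by apply/measurable_EFinP; exact: continuous_measurable_fun.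
have cH : continuous H.
  by move=> x; apply: differentiable_continuous; apply/derivable1_diffP; have [] := dH x.
pose I (n : nat) : set R := `[- n.+1%:R, n.+1%:R]%classic.
have FTC (n : nat) : (\int[mu]_(x in I n) (h x)%:E)%E =
    (H n.+1%:R - H (- n.+1%:R))%:E.
  rewrite (@continuous_FTC2 _ h H) ?EFinB//.
  - by rewrite (@lt_trans _ _ 0) ?oppr_lt0 ?ltr0n.
  - exact: continuous_subspaceT.
  - split.
    + by move=> x _; have [] := dH x.
    + by apply: cvg_at_right_filter; exact: cH.
    + by apply: cvg_at_left_filter; exact: cH.
  - by move=> x _; rewrite derive1E; have [] := dH x.
have mhn n : measurable_fun setT ((fun x : R => (h x)%:E) \_ (I n)).
  by apply/(measurable_restrictT _ _).1; [exact: measurable_itv|exact: measurable_funTS].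
have lim1 : (\int[mu]_(x in I n) (h x)%:E)%E @[n --> \oo]
    --> (\int[mu]_x (h x)%:E)%E.
  rewrite [X in X @ _ --> _](_ : _ = (fun n : nat =>
      \int[mu]_x ((fun x : R => (h x)%:E) \_ (I n)) x)%E); last first.
    by apply/funext => n; rewrite integral_mkcond.
  apply: (@dominated_cvg _ _ R mu setT measurableT
    (fun n : nat => (fun x : R => (h x)%:E) \_ (I n)) (fun x => (h x)%:E)
    (fun x => `|(h x)%:E|%E)).
  - exact: mhn.
  - move=> x _; apply: cvg_near_cst; near=> n.
    rewrite patchE ifT// inE /I/= in_itv/= -ler_norml.
    rewrite (@le_trans _ _ n%:R) ?ler_nat//.
    by near: n; exact: nbhs_infty_ger.
  - by [].
  - exact: integrable_abse.
  - move=> n x _; rewrite patchE; case: ifP => // _.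
    by rewrite abse0.
have lim2 : (\int[mu]_(x in I n) (h x)%:E)%E @[n --> \oo] --> 0%:E.
  rewrite [X in X @ _ --> _](_ : _ = (fun n : nat =>
      (H n.+1%:R - H (- n.+1%:R))%:E)); last by apply/funext => n; rewrite FTC.
  apply: cvg_EFin; first exact: nearW.
  have Hle x : `|H x| <= normal_pdf 0 s `|x|.
    rewrite normrM (ger0_norm (normal_pdf_ge0 _ _ _)).
    rewrite !normal_pdf0E// real_normK ?num_real// -[leRHS]mul1r ler_wpM2r ?sin_max//.
    by rewrite mulr_ge0 ?normal_peak_ge0 ?expR_ge0.
  have gn : normal_pdf 0 s n.+1%:R @[n --> \oo] --> 0.
    by have := cvg_normal_pdf_pinfty sn0; rewrite -(cvg_shiftS (fun n => normal_pdf 0 s n%:R)).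
  have gn2 : 2 * normal_pdf 0 s n.+1%:R @[n --> \oo] --> 0.
    by rewrite -[X in _ --> X](mulr0 2); apply: cvgM; [exact: cvg_cst|exact: gn].
  apply: (@squeeze_cvgr _ _ _ _ (fun n : nat => - (2 * normal_pdf 0 s n.+1%:R))
     (fun n : nat => 2 * normal_pdf 0 s n.+1%:R)).
  - apply: nearW => n; rewrite -ler_norml (le_trans (ler_normB _ _))//.
    have := Hle n.+1%:R; have := Hle (- n.+1%:R).
    by rewrite normrN normr_nat /comp/=; move=> h1 h2; rewrite mulr_natl mulr2n lerD.
  - by rewrite -[X in _ --> X]oppr0; exact: cvgN.
  - exact: gn2.
have h0 : \int[mu]_x h x = 0.
  by rewrite /Rintegral (cvg_unique _ lim1 lim2).
have : \int[mu]_x h x = b * \int[mu]_x (cos (b * x + a) * normal_pdf 0 s x)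
   - s ^- 2 * \int[mu]_x (x * sin (b * x + a) * normal_pdf 0 s x).
  rewrite /h RintegralB//; last 2 first.
  - by have := integrableZl measurableT b ic; apply: eq_integrable.
  - by have := integrableZl measurableT (s ^- 2) is'; apply: eq_integrable.
  by rewrite !RintegralZl.
rewrite h0 => /esym/eqP; rewrite subr_eq0 => /eqP.
move/(congr1 (fun x => s ^+ 2 * x)); rewrite mulVKf ?sqrf_eq0// => <-.
by rewrite mulrA (mulrC b).
Unshelve. all: end_near. Qed.

(* The characteristic function solves the ODE [phi' = - b s^2 phi], obtained by
   differentiating under the integral and integrating by parts. *)
Lemma normal_cf (s b a : R) : 0 < s ->
  \int[normal_prob 0 s]_x cos (b * x + a) = expR (- (b ^+ 2 * s ^+ 2 / 2)) * cos a.
Proof.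
move=> s0.
have maff (c : R) : measurable_fun setT (fun x : R => c * x + a).
  by apply: measurable_funD => //; exact: measurable_funZ.
pose phi (c : R) := \int[mu]_x (cos (c * x + a) * normal_pdf 0 s x).
rewrite Rintegral_normal_prob; last exact/bmeas_cos.
rewrite -/(phi b).
pose f (c x : R) := cos (c * x + a) * normal_pdf 0 s x.
have df (c x : R) : is_derive c 1 (f^~ x) (- (x * sin (c * x + a) * normal_pdf 0 s x)).
  have H := is_derive_cos_affine x a c.
  rewrite [X in is_derive _ _ X _](_ : _ =
    (fun c => normal_pdf 0 s x *: cos (x * c + a))); last first.
    by apply/funext => c'; rewrite /f /GRing.scale /= mulrC (mulrC x).
  apply: (is_derive_eq (is_deriveZ (normal_pdf 0 s x) H)).
  by rewrite /GRing.scale /= (mulrC x c); ring.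
have dphi (c : R) : is_derive c 1 phi (- (c * s ^+ 2 * phi c)).
  have i1 x : `]c - 1, c + 1[%classic x -> mu.-integrable setT (EFin \o f x).
    by move=> _; exact: integrable_cos_normal_pdf.
  have i2 x y : `]c - 1, c + 1[%classic x -> setT y -> derivable (f^~ y) x 1.
    by move=> _ _; have [] := df x y.
  have i3 y : 0 <= `|y| * normal_pdf 0 s y by rewrite mulr_ge0// normal_pdf_ge0.
  have pE x y : partial1of2 f x y = - (y * sin (x * y + a) * normal_pdf 0 s y).
    by rewrite partial1of2E; have [] := df x y.
  have i4 x y : `]c - 1, c + 1[%classic x -> setT y ->
      `|partial1of2 f x y| <= `|y| * normal_pdf 0 s y.
    move=> _ _; rewrite pE normrN !normrM (ger0_norm (normal_pdf_ge0 _ _ _)).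
    by rewrite ler_wpM2r ?normal_pdf_ge0// ler_piMr// sin_max.
  have Ic : `]c - 1, c + 1[%classic c by rewrite /= in_itv/= ltrBlDr ltrDl ltr01.
  have int := integrable_norm_normal_pdf s0.
  have D1 := @derivable_under_integral R _ _ mu f setT measurableT c _ _ Ic i1 i2 _ i3 int i4.
  have D2 := @differentiation_under_integral R _ _ mu f setT measurableT c _ _ Ic i1 i2 _ i3 int i4.
  apply: DeriveDef; first exact: D1.
  rewrite -derive1E [LHS]D2 -integral_sin_normal_pdf// -mulN1r -RintegralZl//; last first.
    exact: integrable_sin_normal_pdf.
  by apply: eq_Rintegral => x _; rewrite pE mulN1r.
(* [psi] is [phi] divided by the expected solution of the ODE; its derivative is 0, so it keeps its
   value at 0. *)
pose psi (c : R) := phi c * expR (- ((- (s ^+ 2 / 2)) * c ^+ 2)).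
have dpsi (c : R) : is_derive c 1 psi 0.
  have H1 := dphi c; have H2 := is_derive_expR_sqr (- (s ^+ 2 / 2)) c.
  by apply: (is_derive_eq (is_deriveM H1 H2)); rewrite /GRing.scale /=; field.
have := is_derive_0_is_cst b 0 dpsi; rewrite /psi.
rewrite expr0n/= mulr0 oppr0 expR0 mulr1 => E.
have -> : phi b = phi 0 * expR (- (b ^+ 2 * s ^+ 2 / 2)).
  rewrite -E -mulrA -expRD [X in expR X](_ : _ = 0) ?expR0 ?mulr1//; by field.
rewrite mulrC; congr (_ * _).
rewrite /phi; under eq_Rintegral do rewrite mul0r add0r.
rewrite RintegralZl//; last exact: integrable_normal_pdf.
by rewrite /Rintegral integral_normal_pdf mulr1.
Qed.

End NormalCfMain.

(** * The normal law as a law on [R] *)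

Section GaussianLaw.
Context {R : realType}.

Lemma measurable_fun_idR : measurable_fun setT (idfun : measurableTypeR R -> R).
Proof. by move=> _ A mA; rewrite setTI. Qed.

HB.instance Definition _ := isMeasurableFun.Build _ _ (measurableTypeR R) R
  (idfun : measurableTypeR R -> R) measurable_fun_idR.

(* [normal_prob] lives on a copy of [R] with the display of Lebesgue measure;
   this is the same law on [R] itself. *)
Definition gaussian (m s : R) : probability R R :=
  distribution (normal_prob m s) (idfun : measurableTypeR R -> R).

Lemma Rintegral_gaussian (m s : R) (h : R -> R) : bmeas h ->
  \int[gaussian m s]_x h x = \int[normal_prob m s]_x h x.
Proof.
move=> bh; congr fine; rewrite integral_distribution//.
  by apply/measurable_EFinP; have [] := bh.
exact: (bmeas_integrable (normal_prob m s) bh).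
Qed.

Lemma gaussian_cf (s b a : R) : 0 < s ->
  \int[gaussian 0 s]_x cos (b * x + a) = expR (- (b ^+ 2 * s ^+ 2 / 2)) * cos a.
Proof.
move=> s0; rewrite Rintegral_gaussian ?normal_cf//; apply: bmeas_cos.
by apply: measurable_funD => //; exact: measurable_funZ.
Qed.

Lemma gaussian_laplace (m s l : R) : 0 < s -> 0 <= l ->
  \int[gaussian m s]_x expR (- (l * (x - m) ^+ 2)) =
  (Num.sqrt (1 + 2 * l * s ^+ 2))^-1.
Proof.
move=> s0 l0; rewrite Rintegral_gaussian ?normal_laplace//.
apply: bmeas_expRN => [|x]; last by rewrite mulr_ge0// sqr_ge0.
by apply: measurable_funZ; apply: measurable_funX; exact: measurable_funB.
Qed.

(** Any normal expectation becomes one under the fixed standard normal law, with a weight. The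
    parameter [m] then sits in the integrand and not in the measure, which is what Fubini needs when
    [m] becomes random. *)
Lemma gaussian_change (m s : R) (h : R -> R) : bmeas h ->
  bmeas (fun y => h y / normal_pdf 0 1 y * normal_pdf m s y) ->
  \int[gaussian 0 1]_y (h y / normal_pdf 0 1 y * normal_pdf m s y) =
  \int[gaussian m s]_y h y.
Proof.
move=> bh bhg; rewrite [LHS](Rintegral_gaussian 0 1 bhg) [RHS](Rintegral_gaussian m s bh).
rewrite [LHS](Rintegral_normal_prob 0 1 bhg) [RHS](Rintegral_normal_prob m s bh).
apply: eq_Rintegral => x _.
rewrite mulrAC divfK// gt_eqF// normal_pdf0E ?oner_eq0// mulr_gt0 ?expR_gt0//.
by rewrite normal_peak_gt0 ?oner_eq0.
Qed.

End GaussianLaw.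

(** * Continuous functions on the plane: measurability and uniform continuity *)

Section PlaneFunctions.
Context {R : realType}.

Lemma cvg_plane {I : Type} {F : set_system I} {FF : Filter F} (f : R * R -> R)
    (u v : I -> R) (x y : R) : {for (x, y), continuous f} ->
  u i @[i --> F] --> x -> v i @[i --> F] --> y ->
  f (u i, v i) @[i --> F] --> f (x, y).
Proof.
move=> cf; apply: (@continuous2_cvg _ _ _ _ F _ u v (fun x y => f (x, y))).
by rewrite [X in X @ _ --> _](_ : _ = f)//; apply/funext => -[].
Qed.

(** The sigma-algebra on the plane is the product one. Rounding the second coordinate down to the
    grid of step 1 / (n + 1) gives functions that depend on the first coordinate alone in each of
    countably many strips, hence are measurable; they converge pointwise to [f] by continuity. *)
Lemma continuous_measurable_plane (f : R * R -> R) :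
  continuous f -> measurable_fun setT f.
Proof.
move=> cf.
pose r (n : nat) (y : R) : R := (Num.floor (n.+1%:R * y))%:~R / n.+1%:R.
have rle n y : `|r n y - y| <= n.+1%:R^-1.
  have n0 : 0 < n.+1%:R :> R by rewrite ltr0n.
  have := floor_le (n.+1%:R * y); have := lt_succ_floor (n.+1%:R * y).
  rewrite intrD /r; set k := _%:~R => h1 h2.
  rewrite ler_norml lerBrDr lerBlDr -(ler_pM2l n0) -[X in _ && X](ler_pM2l n0).
  rewrite mulrDr mulrN mulfV ?gt_eqF// (mulrC _ (k / _)) divfK ?gt_eqF//.
  rewrite mulrDr mulfV ?gt_eqF//; apply/andP; split; first by rewrite addrC lerBlDr ltW.
  by rewrite (le_trans h2)// lerDr.
pose f_ (n : nat) (z : R * R) := f (z.1, r n z.2).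
apply: (@measurable_fun_cvg _ _ _ setT f_) => [n|[x y] _]; last first.
  apply: cvg_plane; [exact: cf|exact: cvg_cst|].
  apply/cvgrPdist_le => e e0; near=> n.
  rewrite distrC (le_trans (rle _ _))//.
  have : (n.+1%:R^-1 : R) < e by near: n; exact: (near_infty_natSinv_lt (PosNum e0)).
  exact: ltW.
move=> _ Y mY; rewrite setTI.
have -> : f_ n @^-1` Y = \bigcup_(k in [set: int])
    ((fun z : R * R => n.+1%:R * z.2) @^-1` `[k%:~R, (k + 1)%:~R[ `&`
     (fun z => f (z.1, k%:~R / n.+1%:R)) @^-1` Y).
  apply/seteqP; split=> [z fz|z [k _ [/= kz]]].
    exists (Num.floor (n.+1%:R * z.2)) => //; split => //=.
    by rewrite in_itv/= floor_le lt_succ_floor.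
  rewrite /f_ /r; suff -> : Num.floor (n.+1%:R * z.2) = k by [].
  by apply: floor_def; rewrite in_itv/= in kz.
apply: countable_bigcupT_measurable => // k; apply: measurableI; rewrite -[X in measurable X]setTI.
  by apply: (measurable_funZ (n.+1%:R) measurable_snd).
have cf1 : continuous (fun x : R => f (x, k%:~R / n.+1%:R)).
  by move=> x; apply: cvg_plane; [exact: cf|exact: cvg_id|exact: cvg_cst].
exact: (measurableT_comp (continuous_measurable_fun cf1) measurable_fst).
Unshelve. all: end_near. Qed.

(** Heine-Cantor on the square of half-side [K], with one of the two points in the square and the
    other arbitrary; if both lie outside, both values are 0. *)
Lemma unif_continuous_plane (f : R * R -> R) (K : R) :
  continuous f -> (forall z, K < `|z.1| \/ K < `|z.2| -> f z = 0) ->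
  forall e, 0 < e -> exists2 d, 0 < d &
    forall y z : R * R, `|y.1 - z.1| < d -> `|y.2 - z.2| < d -> `|f y - f z| <= e.
Proof.
move=> cf f0 e e0.
pose A : set (R * R) := `[- K, K]%classic `*` `[- K, K]%classic.
have cA : compact A by apply: compact_setX; exact: segment_compact.
have inA z : A z \/ f z = 0.
  have [h1|h1] := leP `|z.1| K; last by right; apply: f0; left.
  have [h2|h2] := leP `|z.2| K; last by right; apply: f0; right.
  by left; split; rewrite /= in_itv/= -ler_norml.
pose Q (d : R) (z : R * R) := forall y : R * R,
  `|y.1 - z.1| < d -> `|y.2 - z.2| < d -> `|f y - f z| <= e.
have : \forall d \near 0^'+, A `<=` Q d.
  move/compact_near_coveringP: cA; apply => z Az.
  have e2 : 0 < e / 2 by rewrite divr_gt0.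
  have /cvgrPdist_lt/(_ _ e2) := cf z.
  move/nbhs_ballP => [r /= r0 rf].
  have r2 : 0 < r / 2 by rewrite divr_gt0.
  exists (ball z (r / 2), [set d | d < r / 2]) => /=.
    split; first exact: nbhsx_ballx.
    exact: nbhs_right_lt.
  move=> [z' d] [/= zz' dr] y y1 y2.
  have fz' : `|f z - f z'| < e / 2.
    by apply: rf; apply: le_ball zz'; rewrite ler_pdivrMr// ler_pMr// ler1n.
  have fy : `|f z - f y| < e / 2.
    apply: rf; case: zz' => /= b1 b2.
    have h (a b c : R) : ball a (r / 2) b -> `|c - b| < d -> ball a r c.
      rewrite /ball/= => ab cb; rewrite [r]splitr.
      rewrite (_ : a - c = (a - b) - (c - b)); last by ring.
      by rewrite (le_lt_trans (ler_normB _ _))// ltrD// (lt_trans cb).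
    by split; [exact: h b1 y1|exact: h b2 y2].
  rewrite (_ : f y - f z' = (f z - f z') - (f z - f y)); last by ring.
  by rewrite (le_trans (ler_normB _ _))// [leRHS]splitr lerD// ltW.
move=> H; have H2 : \forall d \near 0^'+, A `<=` Q d /\ 0 < d.
  by apply: filterI H _; exact: nbhs_right_gt.
have [d [dA d0]] := @filter_ex _ _ (at_right_proper_filter (0 : R)) _ H2.
exists d => // y z h1 h2.
have [Az|fz] := inA z; first exact: dA.
have [Ay|fy] := inA y; last by rewrite fy fz subrr normr0 ltW.
by rewrite distrC; apply: (dA _ Ay); rewrite distrC.
Qed.

End PlaneFunctions.

(** * Gaussian smoothing of compactly supported functions *)

Section Smoothing.
Context {R : realType}.
Local Notation gam := (gaussian (0 : R) 1).
Local Notation g := (normal_pdf (0 : R) 1).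

Let g_gt0 x : 0 < g x.
Proof. by rewrite normal_pdf0E ?oner_eq0// mulr_gt0 ?expR_gt0// normal_peak_gt0 ?oner_eq0. Qed.

Let g_le (K x : R) : `|x| <= K -> g K <= g x.
Proof.
move=> xK; rewrite !normal_pdf0E ?oner_eq0// ler_wpM2l ?normal_peak_ge0// ler_expR lerN2.
rewrite ler_wpM2l ?invr_ge0 ?mulrn_wge0 ?sqr_ge0//.
rewrite -(real_normK (num_real x)) lerXn2r// nnegrE//.
exact: le_trans (normr_ge0 x) xK.
Qed.

Lemma bmeas_normal_pdf (m s : R) : s != 0 -> bmeas (normal_pdf m s).
Proof.
move=> s0; split; first exact: measurable_normal_pdf.
exists (normal_peak s) => x; rewrite ger0_norm ?normal_pdf_ge0//.
exact: normal_pdf_ub.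
Qed.

Let bmeas_divg (K : R) (h : R -> R) : bmeas h -> (forall x, K < `|x| -> h x = 0) ->
  bmeas (fun x => h x / g x).
Proof.
move=> [mh [M hM]] h0; split.
  apply: measurable_funM => //; apply: measurable_funV.
  exact: measurable_normal_pdf.
exists (M / g K) => x; have [xK|xK] := leP `|x| K; last first.
  by rewrite h0// mul0r normr0 divr_ge0 ?(ltW (g_gt0 _))// (le_trans _ (hM 0)).
rewrite normrM normfV ler_pM ?invr_ge0// (ger0_norm (ltW (g_gt0 _))).
by rewrite lef_pV2 ?posrE// g_le.
Qed.

Section Fixed.
Variables (K : R) (f : R * R -> R).
Hypothesis bf : bmeas f.
Hypothesis f0 : forall z, K < `|z.1| \/ K < `|z.2| -> f z = 0.

(** The reciprocal of the standard density is unbounded, but on the square that carries [f] it is at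
    most its value at the corner [(K, K)]. *)
Lemma bmeas_div_pdf : bmeas (fun y => f y / (g y.1 * g y.2)).
Proof.
have [mf [M fM]] := bf; split.
  apply: measurable_funM => //; apply: measurable_funV; apply: measurable_funM.
  - exact: measurableT_comp (measurable_normal_pdf 0 1) measurable_fst.
  - exact: measurableT_comp (measurable_normal_pdf 0 1) measurable_snd.
have gg0 x y : 0 < g x * g y by rewrite mulr_gt0.
have M0 : 0 <= M by rewrite (le_trans _ (fM 0)).
exists (M / (g K * g K)) => y.
have b0 : 0 <= M / (g K * g K) by rewrite divr_ge0// ltW.
have [x1|x1] := leP `|y.1| K; last by rewrite f0 ?mul0r ?normr0//; left.
have [x2|x2] := leP `|y.2| K; last by rewrite f0 ?mul0r ?normr0//; right.
rewrite normrM normfV ler_pM ?invr_ge0// (ger0_norm (ltW (gg0 _ _))).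
rewrite lef_pV2 ?posrE//; apply: ler_pM; rewrite ?(ltW (g_gt0 _))//; exact: g_le.
Qed.

Let integral_change (m s : R) (h : R -> R) : s != 0 -> bmeas h ->
  (forall x, K < `|x| -> h x = 0) ->
  \int[gam]_y (h y / g y * normal_pdf m s y) = \int[gaussian m s]_y h y.
Proof.
move=> s0 bh h0.
have bhg : bmeas (fun y => h y / g y * normal_pdf m s y).
  by apply: bmeasM; [exact: bmeas_divg h0|exact: bmeas_normal_pdf].
exact: gaussian_change.
Qed.

(** The convolution of [f] with the centered normal law of covariance s^2 I, that is, the mean of f
    (z + s N) for a standard normal N, written with weights relative to the standard normal law. The
    point [z] enters only through two densities, which can be expanded into cosines. *)
Definition gauss_smooth (s : R) (z : R * R) : R :=
  \int[(gam \x gam)%E]_y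
    (f y / (g y.1 * g y.2) * (normal_pdf z.1 s y.1 * normal_pdf z.2 s y.2)).

Let gauss_smoothE s z : s != 0 -> gauss_smooth s z =
  \int[(gaussian z.1 s \x gaussian z.2 s)%E]_y f y.
Proof.
move=> s0; have bk : bmeas (fun y : R * R =>
    f y / (g y.1 * g y.2) * (normal_pdf z.1 s y.1 * normal_pdf z.2 s y.2)).
  apply: bmeasM; first exact: bmeas_div_pdf.
  apply: bmeasM.
    exact: (bmeas_comp (f := normal_pdf z.1 s) measurable_fst (bmeas_normal_pdf _ s0)).
  exact: (bmeas_comp (f := normal_pdf z.2 s) measurable_snd (bmeas_normal_pdf _ s0)).
rewrite /gauss_smooth (RintE_prod gam gam bk).
rewrite (RintE_prod (gaussian z.1 s) (gaussian z.2 s) bf).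
pose h1 y1 := \int[gaussian z.2 s]_y2 f (y1, y2).
have bh1 : bmeas h1 by exact: (bmeas_Rint (gaussian 0 1) (gaussian z.2 s) bf).
have bf1 y1 : bmeas (fun y2 => f (y1, y2)) by exact: (bmeas_pair1 y1 bf).
have h10 x : K < `|x| -> h1 x = 0.
  move=> Kx; transitivity (\int[gaussian z.2 s]_y (0 : R)); last exact: RintE_cst.
  by apply: eq_Rintegral => y _; rewrite f0//; left.
rewrite -[RHS](integral_change z.1 s0 bh1 h10).
apply: eq_Rintegral => y1 _ /=.
have f10 x : K < `|x| -> f (y1, x) = 0 by move=> Kx; rewrite f0//; right.
rewrite /h1 -(integral_change z.2 s0 (bf1 y1) f10).
rewrite mulrAC (mulrC _ (normal_pdf _ _ _)) -mulrA (mulrC _ (g y1)^-1) mulrA -RintE_Z; last first.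
  by apply: bmeasM; [exact: bmeas_divg f10|exact: bmeas_normal_pdf].
by apply: eq_Rintegral => y2 _; rewrite invfM; ring.
Qed.

Lemma bmeas_gauss_smooth (s : R) : 0 < s -> bmeas (gauss_smooth s).
Proof.
move=> s0; have sn0 : s != 0 by rewrite gt_eqF.
have bk : bmeas (fun p : (R * R) * (R * R) => f p.2 / (g p.2.1 * g p.2.2) *
    (normal_pdf p.1.1 s p.2.1 * normal_pdf p.1.2 s p.2.2)).
  apply: bmeasM; first exact: (bmeas_comp measurable_snd bmeas_div_pdf).
  have m1 : measurable_fun setT (fun p : (R * R) * (R * R) => p.2.1 - p.1.1).
    exact: (measurable_funB (measurableT_comp measurable_fst measurable_snd)
      (measurableT_comp measurable_fst measurable_fst)).
  have m2 : measurable_fun setT (fun p : (R * R) * (R * R) => p.2.2 - p.1.2).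
    exact: (measurable_funB (measurableT_comp measurable_snd measurable_snd)
      (measurableT_comp measurable_snd measurable_fst)).
  rewrite (_ : (fun p => _) = fun p : (R * R) * (R * R) =>
    normal_pdf 0 s (p.2.1 - p.1.1) * normal_pdf 0 s (p.2.2 - p.1.2)).
    exact: (bmeasM (bmeas_comp m1 (bmeas_normal_pdf 0 sn0))
      (bmeas_comp m2 (bmeas_normal_pdf 0 sn0))).
  by apply/funext => p; rewrite !normal_pdfE// /normal_fun !subr0.
exact: (bmeas_Rint (gam \x gam)%E (gam \x gam)%E bk).
Qed.

(** Within the box of half-side [d] around [z] the integrand deviates by at most [e]; outside it by
    at most 2 M, and the mass outside is bounded by a Markov inequality whose right-hand side tends
    to 0 with [s]. *)
Lemma gauss_smooth_dist (s M e d : R) (z : R * R) : 0 < s ->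
  (forall y, `|f y| <= M) -> 0 < d ->
  (forall y, `|y.1 - z.1| < d -> `|y.2 - z.2| < d -> `|f y - f z| <= e) ->
  `|gauss_smooth s z - f z| <=
    e + 2 * M / (1 - expR (- d ^+ 2)) * (2 * (1 - (Num.sqrt (1 + 2 * s ^+ 2))^-1)).
Proof.
move=> s0 fM d0 fe; rewrite gauss_smoothE ?gt_eqF//.
set c := 1 - expR (- d ^+ 2).
have c0 : 0 < c by rewrite subr_gt0 -[ltRHS]expR0 ltr_expR oppr_lt0 exprn_gt0.
have e0 : 0 <= e by rewrite (le_trans _ (fe z _ _))// subrr normr0.
have M0 : 0 <= M by rewrite (le_trans _ (fM z)).
set C := 2 * M / c.
have C0 : 0 <= C by rewrite divr_ge0 ?(ltW c0)// mulr_ge0.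
(* A bounded substitute for the squared distance: at least [c] at distance [d] or more from [m],
   with expectation given by the Laplace transform. *)
pose q (m x : R) := 1 - expR (- (1 * (x - m) ^+ 2)).
have mq (m : R) : measurable_fun setT (fun x : R => 1 * (x - m) ^+ 2).
  apply: measurable_funZ; apply: measurable_funX; apply: measurable_funB => //.
have bq m : bmeas (q m).
  apply: bmeasB; first exact: bmeas_cst.
  by apply: bmeas_expRN => // x; rewrite mul1r sqr_ge0.
have q0 m x : 0 <= q m x.
  by rewrite subr_ge0 -[leRHS]expR0 ler_expR oppr_le0 mul1r sqr_ge0.
have qc m x : d <= `|x - m| -> c <= q m x.
  move=> dx; rewrite lerD2l lerN2 ler_expR lerN2 mul1r -(real_normK (num_real (x - m))).
  by rewrite lerXn2r// nnegrE// ltW.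
have Iq m : \int[gaussian m s]_x q m x = 1 - (Num.sqrt (1 + 2 * s ^+ 2))^-1.
  rewrite RintE_B; [|exact: bmeas_cst|]; last first.
    by apply: bmeas_expRN => // x; rewrite mul1r sqr_ge0.
  by rewrite RintE_cst gaussian_laplace// mulr1.
rewrite -[X in `|_ - X|](RintE_cst (gaussian z.1 s \x gaussian z.2 s)%E (f z)).
pose h (y : R * R) := e + C * (q z.1 y.1 + q z.2 y.2).
have bq1 : bmeas (fun y : R * R => q z.1 y.1) by exact: bmeas_comp measurable_fst (bq _).
have bq2 : bmeas (fun y : R * R => q z.2 y.2) by exact: bmeas_comp measurable_snd (bq _).
have I1 : \int[(gaussian z.1 s \x gaussian z.2 s)%E]_y q z.1 y.1 =
    1 - (Num.sqrt (1 + 2 * s ^+ 2))^-1.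
  rewrite (RintE_prod (gaussian z.1 s) (gaussian z.2 s) bq1) -(Iq z.1).
  by apply: eq_Rintegral => y _; exact: (RintE_cst (gaussian z.2 s) (q z.1 y)).
have I2 : \int[(gaussian z.1 s \x gaussian z.2 s)%E]_y q z.2 y.2 =
    1 - (Num.sqrt (1 + 2 * s ^+ 2))^-1.
  rewrite (RintE_prod2 (gaussian z.1 s) (gaussian z.2 s) bq2) -(Iq z.2).
  by apply: eq_Rintegral => y _; exact: (RintE_cst (gaussian z.1 s) (q z.2 y)).
have bh : bmeas h.
  by apply: bmeasD; [exact: bmeas_cst|apply: bmeasM; [exact: bmeas_cst|exact: bmeasD]].
apply: (le_trans (RintE_dist_le _ bf (bmeas_cst (f z)) bh _)) => [y|]; last first.
  rewrite RintE_D; [|exact: bmeas_cst|by apply: bmeasM; [exact: bmeas_cst|exact: bmeasD]].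
  rewrite RintE_cst RintE_Z; last exact: bmeasD.
  rewrite (RintE_D _ bq1 bq2) I1 I2.
  by rewrite [leRHS](_ : _ = e + C * (1 - (Num.sqrt (1 + 2 * s ^+ 2))^-1 +
    (1 - (Num.sqrt (1 + 2 * s ^+ 2))^-1)))//; ring.
have big : c <= q z.1 y.1 + q z.2 y.2 -> `|f y - f z| <= h y.
  move=> cq; rewrite (le_trans (ler_normB _ _))// (@le_trans _ _ (2 * M))//.
    by rewrite mulr_natl mulr2n; apply: lerD; exact: fM.
  rewrite /h ler_wpDl// /C mulrAC ler_pdivlMr// ler_wpM2l//; exact: mulr_ge0.
have [y1|y1] := ltP `|y.1 - z.1| d; last by apply: big; rewrite -[c]addr0 lerD ?qc.
have [y2|y2] := ltP `|y.2 - z.2| d; last by apply: big; rewrite -[c]add0r lerD ?qc.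
by rewrite (le_trans (fe _ y1 y2))// /h lerDl mulr_ge0// addr_ge0.
Qed.

(** Fourier self-duality of the Gaussian: up to the factor [normal_peak s] per coordinate, the
    density at y is the characteristic function of a standard normal variable at (y - z) / s. *)
Lemma normal_pdf_prod_cf (s z1 z2 y1 y2 : R) : 0 < s ->
  normal_pdf z1 s y1 * normal_pdf z2 s y2 = normal_peak s ^+ 2 *
  \int[(gam \x gam)%E]_t cos ((y1 - z1) / s * t.1 + (y2 - z2) / s * t.2).
Proof.
move=> s0.
have mt (a b : R) : measurable_fun setT (fun t : R * R => a * t.1 + b * t.2).
  exact: (measurable_funD (measurable_funZ a measurable_fst) (measurable_funZ b measurable_snd)).
have bct : bmeas (fun t : R * R => cos ((y1 - z1) / s * t.1 + (y2 - z2) / s * t.2)).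
  exact: bmeas_cos (mt _ _).
rewrite (RintE_prod gam gam bct).
under eq_Rintegral => t1 _.
  under eq_Rintegral do rewrite /= addrC.
  rewrite gaussian_cf ?ltr01//= -[X in cos X]addr0.
  over.
rewrite RintE_Z; last first.
  by apply: bmeas_cos; apply: measurable_funD => //; exact: measurable_funZ.
rewrite gaussian_cf ?ltr01// cos0 mulr1 -expRD !normal_pdfE ?gt_eqF// /normal_fun.
rewrite mulrACA -expr2 -expRD; congr (_ * expR _).
by rewrite -!(mulr_natr (s ^+ 2)); field; rewrite gt_eqF.
Qed.

Section Law.
Context {d} {T : measurableType d} (P : probability T R) (X : T -> R * R).
Hypothesis mX : measurable_fun setT X.

(* The law of [X] enters the smoothed expectation only through its
   characteristic function. *)
Lemma Rintegral_gauss_smooth (s : R) : 0 < s ->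
  \int[P]_w gauss_smooth s (X w) =
  \int[(gam \x gam)%E]_y (f y / (g y.1 * g y.2) * (normal_peak s ^+ 2 *
    \int[(gam \x gam)%E]_t \int[P]_w
      cos (- (t.1 / s) * (X w).1 + (- (t.2 / s)) * (X w).2
           + (t.1 * y.1 / s + t.2 * y.2 / s)))).
Proof.
move=> s0; have sn0 : s != 0 by rewrite gt_eqF.
have mX1 : measurable_fun setT (fun w => (X w).1) by exact: measurableT_comp mX.
have mX2 : measurable_fun setT (fun w => (X w).2) by exact: measurableT_comp mX.
have pdf_shift (m x : R) : normal_pdf m s x = normal_pdf 0 s (x - m).
  by rewrite !normal_pdfE// /normal_fun subr0.
have mpdf : measurable_fun setT (fun p : T * (R * R) =>
    normal_pdf (X p.1).1 s p.2.1 * normal_pdf (X p.1).2 s p.2.2).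
  under eq_fun do rewrite pdf_shift [X in _ * X]pdf_shift.
  apply: measurable_funM.
    apply: measurableT_comp (measurable_normal_pdf 0 s) _.
    apply: measurable_funB; first exact: measurableT_comp measurable_fst measurable_snd.
    exact: measurableT_comp mX1 measurable_fst.
  apply: measurableT_comp (measurable_normal_pdf 0 s) _.
  apply: measurable_funB; first exact: measurableT_comp measurable_snd measurable_snd.
  exact: measurableT_comp mX2 measurable_fst.
pose ker (p : T * (R * R)) := f p.2 / (g p.2.1 * g p.2.2) *
  (normal_pdf (X p.1).1 s p.2.1 * normal_pdf (X p.1).2 s p.2.2).
have bpdf : bmeas (fun p : T * (R * R) =>
    normal_pdf (X p.1).1 s p.2.1 * normal_pdf (X p.1).2 s p.2.2).
  split=> //; exists (normal_peak s * normal_peak s) => p.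
  by rewrite normrM ler_pM// ger0_norm ?normal_pdf_ge0// normal_pdf_ub.
have bker : bmeas ker.
  exact: (bmeasM (bmeas_comp measurable_snd bmeas_div_pdf) bpdf).
rewrite /gauss_smooth (RintE_swap P (gam \x gam)%E bker).
apply: eq_Rintegral => y _; rewrite /ker /=.
rewrite RintE_Z; last first.
  exact: (bmeas_pair2 y bpdf).
congr (_ * _).
under eq_Rintegral do rewrite normal_pdf_prod_cf//.
have mcos : measurable_fun setT (fun p : T * (R * R) =>
   (y.1 - (X p.1).1) / s * p.2.1 + (y.2 - (X p.1).2) / s * p.2.2).
  apply: measurable_funD; apply: measurable_funM.
  - apply: measurable_funM => //; apply: measurable_funB => //.
    exact: measurableT_comp mX1 measurable_fst.
  - exact: measurableT_comp measurable_fst measurable_snd.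
  - apply: measurable_funM => //; apply: measurable_funB => //.
    exact: measurableT_comp mX2 measurable_fst.
  - exact: measurableT_comp measurable_snd measurable_snd.
have bcos := bmeas_cos mcos.
rewrite RintE_Z; last exact: (bmeas_Rint P (gam \x gam)%E bcos).
congr (_ * _); rewrite (RintE_swap P (gam \x gam)%E bcos).
apply: eq_Rintegral => t _; apply: eq_Rintegral => w _; congr cos => /=.
by field.
Qed.

End Law.
End Fixed.
End Smoothing.

(** * Continuity theorem in the plane *)

Section Levy.
Context {R : realType} {d d'} {T : measurableType d} {T' : measurableType d'}.
Variables (P : probability T R) (P' : probability T' R).
Variables (X : nat -> T -> R * R) (Y : T' -> R * R).
Hypotheses (mX : forall n, measurable_fun setT (X n)) (mY : measurable_fun setT Y).
Hypothesis cf_cvg : forall a b c : R,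
  \int[P]_w cos (a * (X n w).1 + b * (X n w).2 + c) @[n --> \oo] -->
  \int[P']_w cos (a * (Y w).1 + b * (Y w).2 + c).
Local Notation gam2 := (gaussian (0 : R) 1 \x gaussian (0 : R) 1)%E.
Local Notation g := (normal_pdf (0 : R) 1).

(** Characteristic functions converge pointwise and are bounded by 1, so bounded convergence applies
    in the frequency [t] for fixed [y], and then in [y]. *)
Lemma cvg_Rintegral_gauss_smooth (K : R) (f : R * R -> R) (s : R) : bmeas f ->
  (forall z, K < `|z.1| \/ K < `|z.2| -> f z = 0) -> 0 < s ->
  \int[P]_w gauss_smooth f s (X n w) @[n --> \oo] --> \int[P']_w gauss_smooth f s (Y w).
Proof.
move=> bf f0 s0.
rewrite (Rintegral_gauss_smooth bf f0 P' mY s0).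
rewrite [X in X @ _ --> _](_ : _ = fun n => \int[gam2]_y
  (f y / (g y.1 * g y.2) * (normal_peak s ^+ 2 *
    \int[gam2]_t \int[P]_w
      cos (- (t.1 / s) * (X n w).1 + (- (t.2 / s)) * (X n w).2
           + (t.1 * y.1 / s + t.2 * y.2 / s))))); last first.
  by apply/funext => n; exact: (Rintegral_gauss_smooth bf f0 P (mX n) s0).
have bfg := bmeas_div_pdf bf f0.
have [mfg [M fgM]] := bfg.
have bcos n : bmeas (fun p : ((R * R) * (R * R)) * T =>
    cos (- (p.1.2.1 / s) * (X n p.2).1 + (- (p.1.2.2 / s)) * (X n p.2).2
           + (p.1.2.1 * p.1.1.1 / s + p.1.2.2 * p.1.1.2 / s))).
  apply: bmeas_cos.
  have m1 : measurable_fun setT (fun p : ((R * R) * (R * R)) * T => p.1.2.1).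
    exact: (measurableT_comp measurable_fst (measurableT_comp measurable_snd measurable_fst)).
  have m2 : measurable_fun setT (fun p : ((R * R) * (R * R)) * T => p.1.2.2).
    exact: (measurableT_comp measurable_snd (measurableT_comp measurable_snd measurable_fst)).
  have m3 : measurable_fun setT (fun p : ((R * R) * (R * R)) * T => p.1.1.1).
    exact: (measurableT_comp measurable_fst (measurableT_comp measurable_fst measurable_fst)).
  have m4 : measurable_fun setT (fun p : ((R * R) * (R * R)) * T => p.1.1.2).
    exact: (measurableT_comp measurable_snd (measurableT_comp measurable_fst measurable_fst)).
  have m5 : measurable_fun setT (fun p : ((R * R) * (R * R)) * T => (X n p.2).1).
    exact: (measurableT_comp measurable_fst (measurableT_comp (mX n) measurable_snd)).
  have m6 : measurable_fun setT (fun p : ((R * R) * (R * R)) * T => (X n p.2).2).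
    exact: (measurableT_comp measurable_snd (measurableT_comp (mX n) measurable_snd)).
  have ms : measurable_fun setT (fun p : ((R * R) * (R * R)) * T => s^-1).
    exact: measurable_cst.
  have mN (h : ((R * R) * (R * R)) * T -> R) :
    measurable_fun setT h -> measurable_fun setT (fun p => - h p) by exact: measurable_funN.
  apply: measurable_funD; apply: measurable_funD.
  - exact: (measurable_funM (mN _ (measurable_funM m1 ms)) m5).
  - exact: (measurable_funM (mN _ (measurable_funM m2 ms)) m6).
  - exact: (measurable_funM (measurable_funM m1 m3) ms).
  - exact: (measurable_funM (measurable_funM m2 m4) ms).
have bphi n := bmeas_Rint (gam2 \x gam2)%E P (bcos n).
have bpsi n := bmeas_Rint gam2 gam2 (bphi n).
have phi1 n (y t : R * R) : `|\int[P]_w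
      cos (- (t.1 / s) * (X n w).1 + (- (t.2 / s)) * (X n w).2
           + (t.1 * y.1 / s + t.2 * y.2 / s))| <= 1.
  apply: RintE_norm_le => [|w]; last exact: cos_max.
  exact: (bmeas_pair1 (y, t) (bcos n)).
apply: (@RintE_cvg _ _ _ _ _ _ (M * (normal_peak s ^+ 2 * 1))) => [n|n y|y].
- apply: measurable_funM => //; apply: measurable_funM; first exact: measurable_cst.
  by have [] := bpsi n.
- rewrite normrM ler_pM// normrM ler_pM//.
    by rewrite ger0_norm// sqr_ge0.
  apply: RintE_norm_le => [|t]; last exact: phi1.
  exact: (bmeas_pair1 y (bphi n)).
- apply: cvgM; first exact: cvg_cst.
  apply: cvgM; first exact: cvg_cst.
  apply: (@RintE_cvg _ _ _ _ _ _ 1) => [n|n t|t].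
  + by have [] := bmeas_pair1 y (bphi n).
  + exact: phi1.
  + exact: cf_cvg.
Qed.

Lemma cvg_Rintegral_compact_support (K : R) (f : R * R -> R) : continuous f ->
  (exists M, forall z, `|f z| <= M) ->
  (forall z, K < `|z.1| \/ K < `|z.2| -> f z = 0) ->
  \int[P]_w f (X n w) @[n --> \oo] --> \int[P']_w f (Y w).
Proof.
move=> cf [M fM] f0.
have bf : bmeas f by split; [exact: continuous_measurable_plane|exists M].
apply/cvgrPdist_le => e e0.
(* Five shares: two for replacing [f] by its smoothing under each of the two laws, one for the
   convergence of the smoothed integrals. *)
have e5 : 0 < e / 5 by rewrite divr_gt0.
have [dl dl0 fdl] := unif_continuous_plane cf f0 e5.
have c0 : 0 < 1 - expR (- dl ^+ 2).
  by rewrite subr_gt0 -[ltRHS]expR0 ltr_expR oppr_lt0 exprn_gt0.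
have M0 : 0 <= M by rewrite (le_trans _ (fM 0)).
set C := 2 * M / (1 - expR (- dl ^+ 2)).
have C0 : 0 <= C by rewrite divr_ge0 ?(ltW c0)// mulr_ge0.
have [s s0 sC] : exists2 s : R, 0 < s &
    C * (2 * (1 - (Num.sqrt (1 + 2 * s ^+ 2))^-1)) <= e / 5.
  (* Since 1 - 1 / sqrt (1 + 2 s^2) <= 2 s^2, the smoothing error is at most 4 C s^2. The choice of
     [s] ensures s <= 1, so that s^2 <= s, and 4 C s <= e / 5. *)
  pose s := (e / 5) / (4 * C + e / 5 + 1).
  have D0 : 0 < 4 * C + e / 5 + 1 by rewrite addr_gt0// ltr_wpDl// mulr_ge0.
  have s0 : 0 < s by rewrite divr_gt0.
  have s1 : s <= 1 by rewrite ler_pdivrMr// mul1r -addrA addrCA lerDl addr_ge0// mulr_ge0.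
  have sC : 4 * C * s <= e / 5.
    rewrite /s mulrCA ler_piMr ?(ltW e5)// ler_pdivrMr// mul1r -addrA lerDl.
    by rewrite addr_ge0// ltW.
  exists s => //; apply: le_trans sC.
  have : 1 - (Num.sqrt (1 + 2 * s ^+ 2))^-1 <= 2 * s ^+ 2.
    set u := 2 * s ^+ 2; have u0 : 0 <= u by rewrite mulr_ge0// sqr_ge0.
    have r1 : 1 <= Num.sqrt (1 + u) by rewrite -[leLHS]sqrtr1 ler_sqrt ?lerDl// addr_ge0.
    have r2 : Num.sqrt (1 + u) ^+ 2 = 1 + u by rewrite sqr_sqrtr// addr_ge0.
    move: (Num.sqrt _) r1 r2 => r r1 r2.
    have r0 : 0 < r by rewrite (lt_le_trans _ r1).
    rewrite lerBlDr -lerBlDl -(ler_pM2r r0) mulVf ?gt_eqF//.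
    have := mulr_ge0 u0 (ltW r0); nra.
  move=> h; rewrite (@le_trans _ _ (C * (2 * (2 * s ^+ 2))))//.
    by rewrite ler_wpM2l// ler_wpM2l.
  have ss : s ^+ 2 <= s by rewrite expr2 ler_piMl// ltW.
  by move: ss C0; move: (s ^+ 2) => ss; nra.
have bfX n : bmeas (fun w => f (X n w)) by exact: bmeas_comp.
have bfY : bmeas (fun w => f (Y w)) by exact: bmeas_comp.
have dist z : `|f z - gauss_smooth f s z| <= 2 * (e / 5).
  rewrite distrC (le_trans (gauss_smooth_dist bf f0 s0 fM dl0 (fun y => fdl y z)))//.
  by rewrite [leRHS](_ : _ = e / 5 + e / 5) ?lerD//; ring.
have bS : bmeas (gauss_smooth f s).
  exact: (bmeas_gauss_smooth bf f0 s0).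
have D d1 (U : measurableType d1) (Q : probability U R) (V : U -> R * R) :
    measurable_fun setT V ->
    `|\int[Q]_w f (V w) - \int[Q]_w gauss_smooth f s (V w)| <= 2 * (e / 5).
  move=> mV; rewrite -[leRHS](RintE_cst Q); apply: RintE_dist_le.
  - exact: bmeas_comp mV bf.
  - exact: bmeas_comp mV bS.
  - exact: bmeas_cst.
  - by move=> w; exact: dist.
have /cvgrPdist_le/(_ _ e5) := cvg_Rintegral_gauss_smooth bf f0 s0.
apply: filterS => n Hn.
have h1 := D _ _ P _ (mX n); have h2 := D _ _ P' _ mY.
rewrite (_ : _ - _ = (\int[P']_w f (Y w) - \int[P']_w gauss_smooth f s (Y w))
  + (\int[P']_w gauss_smooth f s (Y w) - \int[P]_w gauss_smooth f s (X n w))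
  - (\int[P]_w f (X n w) - \int[P]_w gauss_smooth f s (X n w))); last by ring.
rewrite (le_trans (ler_normB _ _))// (@le_trans _ _ (2 * (e / 5) + e / 5 + 2 * (e / 5)))//.
  by rewrite lerD// (le_trans (ler_normD _ _))// lerD.
by rewrite le_eqVlt; apply/orP; left; apply/eqP; field.
Qed.

(** For k >= 0, a continuous cutoff: 1 on [- k, k], 0 outside [- k - 1, k + 1], affine in
    between. *)
Let tent (k : R) (x : R) : R := Num.max 0 (Num.min 1 (k + 1 - `|x|)).

Let tent_ge0 k x : 0 <= tent k x. Proof. by rewrite le_max lexx. Qed.
Let tent_le1 k x : tent k x <= 1. Proof. by rewrite ge_max ler01 ge_min lexx. Qed.

(* The limit is assumed to be the characteristic function of a law, which makes
   tightness automatic. *)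
Lemma levy_plane (f : R * R -> R) : continuous f ->
  (exists M, forall z, `|f z| <= M) ->
  \int[P]_w f (X n w) @[n --> \oo] --> \int[P']_w f (Y w).
Proof.
move=> cf [M fM].
have M0 : 0 <= M by rewrite (le_trans _ (fM 0)).
have bf : bmeas f by split; [exact: continuous_measurable_plane|exists M].
pose chi (k : nat) (z : R * R) := tent k%:R z.1 * tent k%:R z.2.
have ctent (k : R) : continuous (tent k).
  move=> x.
  have h : {for x, continuous (fun x : R => k + 1 - `|x| : R^o)}.
    by apply: cvgB; [exact: cvg_cst|exact: norm_continuous].
  have c0 : {for x, continuous (cst 0 : R -> R^o)} by exact: cst_continuous.
  have c1 : {for x, continuous (cst 1 : R -> R^o)} by exact: cst_continuous.
  have := continuous_max c0 (continuous_min c1 h).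
  by [].
have cchi k : continuous (chi k).
  move=> z; apply: cvgM.
    apply: (@continuous_comp _ _ _ fst (tent k%:R)); last exact: ctent.
    exact: cvg_fst.
  apply: (@continuous_comp _ _ _ snd (tent k%:R)); last exact: ctent.
  exact: cvg_snd.
have chi0 k z : 0 <= chi k z by rewrite mulr_ge0.
have chi1 k z : chi k z <= 1 by rewrite mulr_ile1.
have chiN k z : `|chi k z| <= 1 by rewrite ger0_norm.
have chiS (k : nat) z : k%:R + 1 < `|z.1| \/ k%:R + 1 < `|z.2| -> chi k z = 0.
  have t0 (x : R) : k%:R + 1 < `|x| -> tent k%:R x = 0.
    by move=> h; apply/max_idPl; rewrite ge_min subr_le0 (ltW h) orbT.
  by case=> /t0 h; rewrite /chi h ?mul0r ?mulr0.
have bchi k : bmeas (chi k).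
  by split; [exact: continuous_measurable_plane|exists 1].
have chiY : \int[P']_w chi k (Y w) @[k --> \oo] --> (1 : R).
  rewrite -[X in _ --> X](RintE_cst P').
  apply: (@RintE_cvg _ _ _ _ _ _ 1) => [n|n w|w]; last 1 first.
  - apply: cvg_near_cst; near=> k.
    have tk (x : R) : `|x| <= k%:R -> tent k%:R x = 1.
      move=> xk; rewrite /tent (_ : Num.min _ _ = 1); first by apply/max_idPr.
      by apply/min_idPl; rewrite -addrAC lerDr subr_ge0.
    rewrite /chi !tk ?mulr1//; near: k; exact: nbhs_infty_ger.
  - by have [] := bmeas_comp mY (bchi n).
  - exact: chiN.
apply/cvgrPdist_le => e e0.
(* The final sum is M e' + e' + 2 M e', which is at most 4 (M + 1) e'. *)
pose e' := e / (4 * (M + 1)).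
have M1 : 0 < M + 1 by rewrite ltr_wpDl.
have e'0 : 0 < e' by rewrite divr_gt0// mulr_gt0.
have [k Hk] : exists k, 1 - e' <= \int[P']_w chi k (Y w).
  have /cvgrPdist_le/(_ _ e'0) := chiY.
  move=> /filter_ex[k kP]; exists k.
  by rewrite lerBlDl -lerBlDr (le_trans (ler_norm _) kP).
pose fc z := f z * chi k z.
have cfc : \int[P]_w fc (X n w) @[n --> \oo] --> \int[P']_w fc (Y w).
  apply: (@cvg_Rintegral_compact_support (k%:R + 1)).
  - by move=> z; apply: cvgM; [exact: cf|exact: cchi].
  - exists (M * 1) => z; rewrite normrM ler_pM//.
  - by move=> z /chiS h; rewrite /fc h mulr0.
(* Tightness: the cutoff is itself a compactly supported test function, so the mass 1 - e' that it
   captures under the limit law is captured by [X n] up to a further e' for large n. *)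
have cchiX : \int[P]_w chi k (X n w) @[n --> \oo] --> \int[P']_w chi k (Y w).
  apply: (@cvg_Rintegral_compact_support (k%:R + 1)) => //; last exact: chiS.
  by exists 1.
have bfc : bmeas fc by exact: bmeasM.
have D d1 (U : measurableType d1) (Q : probability U R) (V : U -> R * R) :
    measurable_fun setT V ->
    `|\int[Q]_w f (V w) - \int[Q]_w fc (V w)| <= M * (1 - \int[Q]_w chi k (V w)).
  move=> mV; have bcV := bmeas_comp mV (bchi k).
  have b1 : bmeas (fun w : U => 1 - chi k (V w)) by exact: bmeasB (bmeas_cst 1) bcV.
  have -> : M * (1 - \int[Q]_w chi k (V w)) = \int[Q]_w (M * (1 - chi k (V w))).
    by rewrite (RintE_Z Q M b1) (RintE_B Q (bmeas_cst 1) bcV) RintE_cst.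
  apply: RintE_dist_le.
  - exact: bmeas_comp mV bf.
  - exact: bmeas_comp mV bfc.
  - exact: bmeasM (bmeas_cst M) b1.
  - move=> w; rewrite /fc -[X in X - _]mulr1 -mulrBr normrM ler_pM//.
    by rewrite ger0_norm// subr_ge0.
have /cvgrPdist_le/(_ _ e'0) H1 := cfc; have /cvgrPdist_le/(_ _ e'0) H2 := cchiX.
near=> n.
have h1 := D _ _ P _ (mX n); have h2 := D _ _ P' _ mY.
have h3 : `|\int[P']_w fc (Y w) - \int[P]_w fc (X n w)| <= e' by near: n.
have h4 : `|\int[P']_w chi k (Y w) - \int[P]_w chi k (X n w)| <= e' by near: n.
have h5 : M * (1 - \int[P]_w chi k (X n w)) <= M * (2 * e').
  rewrite ler_wpM2l//; have := le_trans (ler_norm _) h4; move: Hk; lra.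
have h6 : M * (1 - \int[P']_w chi k (Y w)) <= M * e'.
  rewrite ler_wpM2l//; move: Hk; lra.
rewrite (_ : _ - _ = (\int[P']_w f (Y w) - \int[P']_w fc (Y w))
  + (\int[P']_w fc (Y w) - \int[P]_w fc (X n w))
  - (\int[P]_w f (X n w) - \int[P]_w fc (X n w))); last by ring.
rewrite (le_trans (ler_normB _ _))// (@le_trans _ _ (M * e' + e' + M * (2 * e')))//.
  rewrite lerD ?(le_trans h1 h5)// (le_trans (ler_normD _ _))// lerD//.
  exact: le_trans h2 h6.
have -> : e = 4 * (M + 1) * e' by rewrite /e'; field; rewrite gt_eqF.
by move: M0 e'0; move: (e') => z; nra.
Unshelve. all: end_near. Qed.

End Levy.

(** * Image laws and independence of two random elements *)

Section Law.
Context {R : realType} {d d'} {T : measurableType d} {S : measurableType d'}.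
Variables (P : probability T R) (V : T -> S).
Hypothesis mV : measurable_fun setT V.

Definition law : probability S R := distribution P
  (MeasurableFun.Pack (MeasurableFun.Class (isMeasurableFun.Build _ _ _ _ _ mV))).

Lemma Rintegral_law (h : S -> R) : bmeas h -> \int[law]_x h x = \int[P]_w h (V w).
Proof.
move=> bh; congr fine; rewrite integral_distribution//.
  by apply/measurable_EFinP; have [] := bh.
exact: (bmeas_integrable P (bmeas_comp mV bh)).
Qed.

Lemma measurable_pre (A : set S) : measurable A -> measurable (V @^-1` A).
Proof. by move=> mA; rewrite -[X in measurable X]setTI; exact: mV. Qed.

(** For fixed [E], both sides are finite measures in [A]: the image under [V] of [P] restricted to
    [E], and the law of [V] scaled by P(E). They agree on a generating pi-system, hence
    everywhere. *)
Lemma indep_pi_system (G : set (set S)) (g : nat -> set S) (E : set T) :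
  @measurable _ S = <<s G >> -> setI_closed G -> (forall i, G (g i)) ->
  \bigcup_i g i = setT -> measurable E ->
  (forall A, G A -> P (V @^-1` A `&` E) = (P (V @^-1` A) * P E)%E) ->
  forall A, measurable A -> P (V @^-1` A `&` E) = (P (V @^-1` A) * P E)%E.
Proof.
move=> mG IG Gg cg mE H A mA.
have PE0 : 0 <= fine (P E) by rewrite fine_ge0.
have PEf : P E \is a fin_num by exact: fin_num_measure.
pose m1' : {measure set S -> \bar R} := pushforward (mrestr P mE) V.
pose m1 := m1' mV.
pose m2 : {measure set S -> \bar R} := mscale (NngNum PE0) law.
suff : m1 A = m2 A by rewrite /m2 /= /mscale /= fineK// muleC.
apply: (measure_unique G g mG IG Gg cg m1 m2) => [B GB|k|//].
  by rewrite /m2 /= /mscale /= fineK// muleC; exact: H.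
rewrite /m1 /m1' /= /pushforward /mrestr (le_lt_trans _ (ltry 1))//.
apply: probability_le1; apply: measurableI => //; apply: measurable_pre.
by rewrite mG; apply: sub_sigma_algebra.
Qed.

End Law.

Section Independence.
Context {R : realType} {d d1 d2} {T : measurableType d}
  {S1 : measurableType d1} {S2 : measurableType d2}.
Variables (P : probability T R) (V : T -> S1) (W : T -> S2).
Hypotheses (mV : measurable_fun setT V) (mW : measurable_fun setT W).

Definition indep : Prop := forall A B, measurable A -> measurable B ->
  P (V @^-1` A `&` W @^-1` B) = (P (V @^-1` A) * P (W @^-1` B))%E.

(* Under independence, the two arguments can be integrated over separate copies
   of the sample space. *)
Lemma indep_Rintegral (F : S1 * S2 -> R) : indep -> bmeas F ->
  \int[P]_w F (V w, W w) = \int[P]_w \int[P]_w' F (V w, W w').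
Proof.
move=> iVW bF.
have mVW : measurable_fun setT (fun w => (V w, W w)) by exact: measurable_fun_pair.
rewrite -(Rintegral_law P mVW bF).
rewrite -(@eq_RintE _ _ _ (law P mV \x law P mW)%E (law P mVW)); last first.
  move=> X mX.
  by apply: (@product_measure_unique _ _ _ _ _ (law P mV) (law P mW) (law P mVW)).
rewrite (RintE_prod (law P mV) (law P mW) bF).
have bG := bmeas_Rint (law P mV) (law P mW) bF.
rewrite (Rintegral_law P mV bG).
apply: eq_Rintegral => w _.
by rewrite (Rintegral_law P mW (bmeas_pair1 (V w) bF)).
Qed.

Lemma indep_pi_systems (G1 : set (set S1)) (G2 : set (set S2))
    (g1 : nat -> set S1) (g2 : nat -> set S2) :
  @measurable _ S1 = <<s G1 >> -> setI_closed G1 -> (forall i, G1 (g1 i)) ->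
  \bigcup_i g1 i = setT ->
  @measurable _ S2 = <<s G2 >> -> setI_closed G2 -> (forall i, G2 (g2 i)) ->
  \bigcup_i g2 i = setT ->
  (forall A B, G1 A -> G2 B ->
    P (V @^-1` A `&` W @^-1` B) = (P (V @^-1` A) * P (W @^-1` B))%E) -> indep.
Proof.
move=> mG1 IG1 Gg1 cg1 mG2 IG2 Gg2 cg2 H A B mA mB.
rewrite setIC muleC.
apply: (indep_pi_system mW mG2 IG2 Gg2 cg2) => // [|B' GB']; first exact: measurable_pre.
rewrite setIC muleC.
apply: (indep_pi_system mV mG1 IG1 Gg1 cg1) => // [|A' GA'].
  by apply: measurable_pre => //; rewrite mG2; exact: sub_sigma_algebra.
exact: H.
Qed.

End Independence.

(** * Independence from factorised characteristic functions *)

Section IndependenceFromCf.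
Context {R : realType} {d} {T : measurableType d}.
Variables (P : probability T R) (U V : T -> R).
Hypotheses (mU : measurable_fun setT U) (mV : measurable_fun setT V).

(** Continuous functions that increase with [k] to the indicator of the open half-line above [x]. *)
Let ramp (x : R) (k : nat) (u : R) : R := Num.min 1 (k%:R * Num.max 0 (u - x)).

Let continuous_ramp x k : continuous (ramp x k).
Proof.
move=> u.
have h : {for u, continuous (fun u : R => u - x : R^o)}.
  by apply: cvgB; [exact: cvg_id|exact: cvg_cst].
have c0 : {for u, continuous (cst 0 : R -> R^o)} by exact: cst_continuous.
have c1 : {for u, continuous (cst 1 : R -> R^o)} by exact: cst_continuous.
have h2 : {for u, continuous (fun u : R => k%:R * Num.max 0 (u - x) : R^o)}.
  by apply: cvgM; [exact: cvg_cst|exact: (continuous_max c0 h)].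
by have := continuous_min c1 h2.
Qed.

Let ramp_ge0 x k u : 0 <= ramp x k u.
Proof. by rewrite le_min ler01 mulr_ge0// le_max lexx. Qed.

Let ramp_le1 x k u : ramp x k u <= 1. Proof. by rewrite ge_min lexx. Qed.

Let cvg_ramp x u : ramp x k u @[k --> \oo] --> (\1_(`]x, +oo[%classic : set R) u : R).
Proof.
apply: cvg_near_cst; near=> k; rewrite indicE.
have [xu|ux] := ltP x u; last first.
  rewrite memNset /=; last by rewrite in_itv/= andbT; apply/negP; rewrite -leNgt.
  by rewrite /ramp (max_idPl _) ?subr_le0// mulr0; apply/min_idPr.
rewrite mem_set/= ?in_itv/= ?xu//; apply/min_idPl.
rewrite (max_idPr _) ?subr_ge0 ?(ltW xu)// -ler_pdivrMr ?subr_gt0// mul1r.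
by near: k; exact: nbhs_infty_ger.
Unshelve. all: end_near. Qed.

(** The hypothesis equates the characteristic functions of [(U, V)] under [P] and of its decoupled
    copy under the product measure. Applied to a constant sequence, the continuity theorem yields
    uniqueness: both give the same integral to bounded continuous functions. Products of ramps pass
    this on to quadrants, and open half-lines form a generating pi-system. *)
Lemma indep_of_cf :
  (forall a b c : R, \int[P]_w cos (a * U w + b * V w + c) =
     \int[P]_w \int[P]_w' cos (a * U w + b * V w' + c)) ->
  indep P U V.
Proof.
move=> Hcf.
have mUV : measurable_fun setT (fun w => (U w, V w)) by exact: measurable_fun_pair.
have mU' : measurable_fun setT (fun p : T * T => U p.1).
  exact: (measurableT_comp mU measurable_fst).
have mV' : measurable_fun setT (fun p : T * T => V p.2).
  exact: (measurableT_comp mV measurable_snd).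
have mUV' : measurable_fun setT (fun p : T * T => (U p.1, V p.2)).
  exact: measurable_fun_pair.
have Hf (f : R * R -> R) : continuous f -> (exists M, forall z, `|f z| <= M) ->
    \int[P]_w f (U w, V w) = \int[(P \x P)%E]_p f (U p.1, V p.2).
  move=> cf bf.
  have H (a b c : R) : \int[P]_w cos (a * (U w, V w).1 + b * (U w, V w).2 + c) @[n --> \oo] -->
      \int[(P \x P)%E]_p cos (a * (U p.1, V p.2).1 + b * (U p.1, V p.2).2 + c).
    rewrite /= Hcf.
    have bc : bmeas (fun p : T * T => cos (a * U p.1 + b * V p.2 + c)).
      apply: bmeas_cos; apply: measurable_funD; last exact: measurable_cst.
      exact: (measurable_funD (measurable_funZ a mU') (measurable_funZ b mV')).
    rewrite (RintE_prod P P bc); exact: cvg_cst.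
  have := levy_plane (P := P) (P' := (P \x P)%E) (fun _ => mUV) mUV' H cf bf.
  by move/(cvg_lim (@Rhausdorff R)); rewrite lim_cst.
have cover : \bigcup_i (`](- i%:R : R), +oo[%classic) = setT.
  rewrite -subTset => x _; exists (Num.truncn `|x|).+1 => //=.
  rewrite in_itv/= andbT ltrNl (le_lt_trans (ler_norm _))// normrN.
  exact: truncnS_gt.
have mE : @measurable _ R = <<s @RGenOInfty.G R >> by exact: RGenOInfty.measurableE.
have IG : setI_closed (@RGenOInfty.G R).
  move=> _ _ [x ->] [y ->]; exists (Num.max x y).
  by rewrite predeqE => z; split; rewrite /= !in_itv/= !andbT gt_max => /andP.
have Gg i : RGenOInfty.G (`](- i%:R : R), +oo[%classic) by eexists.
apply: (indep_pi_systems mU mV mE IG Gg cover mE IG Gg cover) => _ _ [x ->] [y ->].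
set A : set R := `]x, +oo[%classic; set B : set R := `]y, +oo[%classic.
have mA : measurable A by exact: measurable_itv.
have mB : measurable B by exact: measurable_itv.
have bA : bmeas (\1_A : R -> R).
  by split; [exact: measurable_indic|exists 1 => u; rewrite indicE; case: (_ \in _); rewrite ?normr1 ?normr0].
have bB : bmeas (\1_B : R -> R).
  by split; [exact: measurable_indic|exists 1 => u; rewrite indicE; case: (_ \in _); rewrite ?normr1 ?normr0].
pose f k (z : R * R) := ramp x k z.1 * ramp y k z.2.
have cf k : continuous (f k).
  move=> z; apply: cvgM.
    apply: (@continuous_comp _ _ _ fst (ramp x k)); last exact: continuous_ramp.
    exact: cvg_fst.
  apply: (@continuous_comp _ _ _ snd (ramp y k)); last exact: continuous_ramp.
  exact: cvg_snd.
have f1 k z : `|f k z| <= 1 by rewrite ger0_norm ?mulr_ge0// mulr_ile1.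
have L d' (T' : measurableType d') (Q : probability T' R) (U' V' : T' -> R) :
    measurable_fun setT U' -> measurable_fun setT V' ->
    \int[Q]_w f k (U' w, V' w) @[k --> \oo] --> \int[Q]_w (\1_A (U' w) * \1_B (V' w) : R).
  move=> mU1 mV1; apply: (@RintE_cvg _ _ _ _ _ _ 1) => [k|k w|w]; last 2 first.
  - exact: f1.
  - by apply: cvgM; exact: cvg_ramp.
  - exact: (measurableT_comp (continuous_measurable_plane (cf k)) (measurable_fun_pair mU1 mV1)).
have L1 := L _ _ P U V mU mV.
have L2 := L _ _ (P \x P)%E _ _ mU' mV'.
have E : (fun k => \int[P]_w f k (U w, V w)) =
    (fun k => \int[(P \x P)%E]_p f k (U p.1, V p.2)).
  by apply/funext => k; apply: Hf => //; exists 1.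
rewrite E in L1.
have := cvg_unique (@Rhausdorff R) L1 L2.
have b1 : bmeas (fun p : T * T => \1_A (U p.1) * \1_B (V p.2) : R).
  exact: (bmeasM (bmeas_comp mU' bA) (bmeas_comp mV' bB)).
rewrite (RintE_prod P P b1) /=.
have IE (C : set T) : measurable C -> \int[P]_w (\1_C w : R) = fine (P C).
  by move=> mC; rewrite /Rintegral integral_indic// setIT.
have bBV : bmeas (fun w => \1_B (V w) : R) by exact: bmeas_comp mV bB.
have bAU : bmeas (fun w => \1_A (U w) : R) by exact: bmeas_comp mU bA.
have pA := measurable_pre mU mA; have pB := measurable_pre mV mB.
have -> : \int[P]_w \int[P]_w' (\1_A (U w) * \1_B (V w') : R) =
    fine (P (U @^-1` A)) * fine (P (V @^-1` B)).
  rewrite -(IE _ pA) -(IE _ pB) mulrC -RintE_Z//.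
  by apply: eq_Rintegral => w _; rewrite RintE_Z// mulrC.
have -> : \int[P]_w (\1_A (U w) * \1_B (V w) : R) = fine (P (U @^-1` A `&` V @^-1` B)).
  rewrite -(IE _ (measurableI _ _ pA pB)); apply: eq_Rintegral => w _.
  by rewrite indicI.
move=> Heq.
have f1' : P (U @^-1` A `&` V @^-1` B) \is a fin_num.
  by apply: fin_num_measure; exact: measurableI.
have fA : P (U @^-1` A) \is a fin_num by exact: fin_num_measure.
have fB : P (V @^-1` B) \is a fin_num by exact: fin_num_measure.
by rewrite -(fineK f1') Heq EFinM !fineK.
Qed.

End IndependenceFromCf.

(** * Mutual independence and blocks of variables *)

Section Blocks.
Context {R : realType} {d} {T : measurableType d}.
Variable P : probability T R.

Definition mutually_indep (n : nat) (X : 'I_n -> T -> R) : Prop :=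
  (forall i, measurable_fun setT (X i)) /\
  forall B : 'I_n -> set R, (forall i, measurable (B i)) ->
    P (\bigcap_(i in [set: 'I_n]) (X i @^-1` B i)) = (\prod_(i < n) P (X i @^-1` B i))%E.

Definition tup (n : nat) (X : 'I_n -> T -> R) (w : T) : n.-tuple R := [tuple X i w | i < n].

Lemma measurable_tup (n : nat) (X : 'I_n -> T -> R) :
  (forall i, measurable_fun setT (X i)) -> measurable_fun setT (tup X).
Proof.
move=> mX; apply/measurable_fun_tnthP => i.
by rewrite (_ : _ \o _ = X i)//; apply/funext => w /=; rewrite tnth_mktuple.
Qed.

(** Measurable rectangles: a pi-system generating the sigma-algebra of tuples. Families are packed
    into random tuples so that independence of two random elements covers blocks. *)
Definition boxes (n : nat) : set (set (n.-tuple R)) := fun A =>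
  exists2 B : 'I_n -> set R, forall i, measurable (B i) &
  A = \bigcap_(i in [set: 'I_n]) ((fun t : n.-tuple R => tnth t i) @^-1` B i).
Arguments boxes : clear implicits.

Let preimage_box n (X : 'I_n -> T -> R) (B : 'I_n -> set R) :
  tup X @^-1` (\bigcap_(i in [set: 'I_n]) ((fun t : n.-tuple R => tnth t i) @^-1` B i))
  = \bigcap_(i in [set: 'I_n]) (X i @^-1` B i).
Proof.
apply/seteqP; split => w /= H i _; have := H i I; by rewrite /= tnth_mktuple.
Qed.

Let boxesT n : boxes n setT.
Proof.
exists (fun=> setT) => //; apply/seteqP; split => // t _ i _; exact: I.
Qed.

Let boxesI n : setI_closed (boxes n).
Proof.
move=> _ _ [B mB ->] [C mC ->]; exists (fun i => B i `&` C i).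
  by move=> i; exact: measurableI.
apply/seteqP; split => [t [h1 h2] i _|t h]; first by split; [exact: h1|exact: h2].
by split => i _; have [] := h i I.
Qed.

Let measurable_boxes n : @measurable _ (n.-tuple R) = <<s boxes n >>.
Proof.
apply/seteqP; split.
- apply: smallest_sub; first exact: smallest_sigma_algebra.
  rewrite -bigcup_seq; apply: bigcup_sub => i _ A [Y mY <-]; apply: sub_sigma_algebra.
  exists (fun j => if j == i then Y else setT).
    by move=> j; case: ifP.
  rewrite setTI; apply/seteqP; split => [t Yt j _|t h] /=.
    by case: eqP => [->|].
  by have := h i I; rewrite /= eqxx.
- apply: smallest_sub; first exact: sigma_algebra_measurable.
  move=> _ [B mB ->]; apply: fin_bigcap_measurable => // i _.
  by rewrite -[X in measurable X]setTI; exact: measurable_tnth.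
Qed.

Lemma indep_tup (n m : nat) (X : 'I_n -> T -> R) (Y : 'I_m -> T -> R) :
  (forall i, measurable_fun setT (X i)) -> (forall i, measurable_fun setT (Y i)) ->
  (forall (A : 'I_n -> set R) (B : 'I_m -> set R),
    (forall i, measurable (A i)) -> (forall i, measurable (B i)) ->
    P (\bigcap_(i in [set: 'I_n]) (X i @^-1` A i) `&`
       \bigcap_(i in [set: 'I_m]) (Y i @^-1` B i)) =
    (P (\bigcap_(i in [set: 'I_n]) (X i @^-1` A i)) *
     P (\bigcap_(i in [set: 'I_m]) (Y i @^-1` B i)))%E) ->
  indep P (tup X) (tup Y).
Proof.
move=> mX mY H.
have cov k : \bigcup_(i : nat) [set: k.-tuple R] = setT by rewrite bigcup_const.
apply: (indep_pi_systems (g1 := fun=> setT) (g2 := fun=> setT)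
  (measurable_tup mX) (measurable_tup mY)
  (measurable_boxes n) (@boxesI n) (fun _ => boxesT n) (cov n)
  (measurable_boxes m) (@boxesI m) (fun _ => boxesT m) (cov m)).
move=> _ _ [A mA ->] [B mB ->].
by rewrite !preimage_box; exact: H.
Qed.

Lemma mutually_indep_widen (n : nat) (X : 'I_n.+1 -> T -> R) :
  mutually_indep X -> mutually_indep (fun i : 'I_n => X (widen_ord (leqnSn n) i)).
Proof.
move=> [mX iX]; split => [i|B mB]; first exact: mX.
(* The rectangle is padded with the whole line at the last index, where it contributes the factor
   1. *)
pose C (i : 'I_n.+1) := if insub (i : nat) is Some j then B j else setT.
have mC i : measurable (C i) by rewrite /C; case: insubP.
have CE (i : 'I_n) : C (widen_ord (leqnSn n) i) = B i by rewrite /C /= valK.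
have Cmax : C ord_max = setT by rewrite /C insubF//= ltnn.
have := iX C mC; rewrite big_ord_recr/= Cmax preimage_setT probability_setT mule1.
under eq_bigr do rewrite CE.
move=> <-; congr (P _); apply/seteqP; split => [w h i _|w h i _] /=.
  rewrite /C; case: insubP => //= j _ ji.
  by have := h j I; rewrite /= (_ : widen_ord _ _ = i)//; exact: val_inj.
by have := h (widen_ord (leqnSn n) i) I; rewrite /= CE.
Qed.

(** The inductive step for sums: the last variable is split off, wrapped as a tuple of length 1 so
    that [indep_tup] applies to both blocks. *)
Lemma mutually_indep_last (n : nat) (X : 'I_n.+1 -> T -> R) : mutually_indep X ->
  indep P (tup (fun i : 'I_n => X (widen_ord (leqnSn n) i)))
          (tup (fun _ : 'I_1 => X ord_max)).
Proof.
move=> iX; have [mX HX] := iX; have [_ HX'] := mutually_indep_widen iX.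
apply: indep_tup => // A B mA mB.
rewrite (HX' A mA).
pose C (i : 'I_n.+1) := if insub (i : nat) is Some j then A j else B ord0.
have mC i : measurable (C i) by rewrite /C; case: insubP.
have CE (i : 'I_n) : C (widen_ord (leqnSn n) i) = A i by rewrite /C /= valK.
have Cmax : C ord_max = B ord0 by rewrite /C insubF//= ltnn.
have B1 : \bigcap_(i in [set: 'I_1]) (X ord_max @^-1` B i) = X ord_max @^-1` B ord0.
  by apply/seteqP; split => [w h|w h i _]; [exact: (h ord0 I)|rewrite (ord1 i)].
rewrite B1; have := HX C mC; rewrite big_ord_recr/= Cmax.
under eq_bigr do rewrite CE.
move=> <-; congr (P _); apply/seteqP; split => [w [h1 h2] i _|w h].
  rewrite /C/=; case: insubP => /= [j _ ji|].
    by have := h1 j I; rewrite /= (_ : widen_ord _ _ = i)//; exact: val_inj.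
  rewrite -leqNgt => ni; rewrite (_ : i = ord_max)//; apply/val_inj/eqP => /=.
  by rewrite eqn_leq ni andbT -ltnS.
split; last by have := h ord_max I; rewrite /= Cmax.
by move=> i _; have := h (widen_ord (leqnSn n) i) I; rewrite /= CE.
Qed.

End Blocks.

(** * Transforms of sums of independent normal variables *)

Section GaussianVariables.
Context {R : realType} {d} {T : measurableType d}.
Variable P : probability T R.

(** When v = 0 the law is a Dirac mass and both sides are cos a; otherwise the formula for the
    normal density applies with standard deviation sqrt v. *)
Lemma gauss1_cf (X : T -> R) (v : R) : measurable_fun setT X -> 0 <= v ->
  (forall A, measurable A -> P (X @^-1` A) = gauss1 v A) ->
  forall b a, \int[P]_w cos (b * X w + a) = expR (- (b ^+ 2 * v / 2)) * cos a.
Proof.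
move=> mX v0 HX b a.
have bc : bmeas (fun x : R => cos (b * x + a)).
  by apply: bmeas_cos; apply: measurable_funD => //; exact: measurable_funZ.
rewrite -(Rintegral_law P mX bc).
have [v_0|vn0] := eqVneq v 0.
  rewrite (@eq_RintE _ _ _ _ (\d_(0 : R))); last first.
    by move=> A mA; rewrite [LHS](HX _ mA) /gauss1 v_0 eqxx.
  rewrite /Rintegral integral_dirac//; last by have [mc _] := bc; exact/measurable_EFinP.
  by rewrite diracT mul1e v_0 !mulr0 !mul0r oppr0 expR0 mul1r add0r.
have v1 : 0 < v by rewrite lt_neqAle eq_sym vn0.
rewrite (@eq_RintE _ _ _ _ (gaussian 0 (Num.sqrt v))); last first.
  by move=> A mA; rewrite [LHS](HX _ mA) /gauss1 (negbTE vn0).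
by rewrite gaussian_cf ?sqrtr_gt0// sqr_sqrtr.
Qed.

Lemma gauss1_laplace (X : T -> R) (v : R) : measurable_fun setT X -> 0 < v ->
  (forall A, measurable A -> P (X @^-1` A) = gauss1 v A) ->
  forall l, 0 <= l ->
  \int[P]_w expR (- (l * X w ^+ 2)) = (Num.sqrt (1 + 2 * l * v))^-1.
Proof.
move=> mX v0 HX l l0.
have bc : bmeas (fun x : R => expR (- (l * x ^+ 2))).
  apply: bmeas_expRN => [|x]; last by rewrite mulr_ge0// sqr_ge0.
  by apply: measurable_funZ; exact: measurable_funX.
rewrite -(Rintegral_law P mX bc).
rewrite (@eq_RintE _ _ _ _ (gaussian 0 (Num.sqrt v))); last first.
  by move=> A mA; rewrite [LHS](HX _ mA) /gauss1 gt_eqF.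
have sv0 : 0 < Num.sqrt v by rewrite sqrtr_gt0.
rewrite -[in RHS](sqr_sqrtr (ltW v0)) -(gaussian_laplace 0 sv0 l0).
by apply: eq_Rintegral => x _; rewrite subr0.
Qed.

Lemma measurable_lin_tuple (n : nat) (b : 'I_n -> R) :
  measurable_fun setT (fun t : n.-tuple R => \sum_(i < n) b i * tnth t i).
Proof.
by apply: measurable_sum => i; apply: measurable_funZ; exact: measurable_tnth.
Qed.

Lemma cf_sum (v : R) (n : nat) (X : 'I_n -> T -> R) : mutually_indep P X ->
  (forall i b a, \int[P]_w cos (b * X i w + a) = expR (- (b ^+ 2 * v / 2)) * cos a) ->
  forall (b : 'I_n -> R) a, \int[P]_w cos (\sum_(i < n) b i * X i w + a) =
    expR (- (\sum_(i < n) b i ^+ 2 * v / 2)) * cos a.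
Proof.
elim: n X => [|n IH] X iX HX b a.
  rewrite big_ord0 oppr0 expR0 mul1r -[RHS](RintE_cst P).
  by apply: eq_Rintegral => w _; rewrite big_ord0 add0r.
have [mX _] := iX.
pose F (p : n.-tuple R * 1.-tuple R) := cos (b ord_max * tnth p.2 ord0 +
  (\sum_(i < n) b (widen_ord (leqnSn n) i) * tnth p.1 i + a)).
have m1 : measurable_fun setT (fun p : n.-tuple R * 1.-tuple R =>
    \sum_(i < n) b (widen_ord (leqnSn n) i) * tnth p.1 i).
  exact: (measurableT_comp (measurable_lin_tuple _) measurable_fst).
have m2 : measurable_fun setT (fun p : n.-tuple R * 1.-tuple R => tnth p.2 ord0).
  exact: (measurableT_comp (measurable_tnth ord0) measurable_snd).
have bF : bmeas F.
  apply: bmeas_cos; apply: measurable_funD; first exact: measurable_funZ.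
  by apply: measurable_funD => //; exact: measurable_cst.
have iL := mutually_indep_last iX.
have mt1 : measurable_fun setT (tup (fun i : 'I_n => X (widen_ord (leqnSn n) i))).
  by apply: measurable_tup.
have mt2 : measurable_fun setT (tup (fun _ : 'I_1 => X ord_max)) by apply: measurable_tup.
have := indep_Rintegral mt1 mt2 iL bF.
rewrite (_ : \int[P]_w _ = \int[P]_w cos (\sum_(i < n.+1) b i * X i w + a)); last first.
  apply: eq_Rintegral => w _; rewrite /F /= tnth_mktuple big_ord_recr/=.
  under eq_bigr do rewrite tnth_mktuple.
  by congr cos; ring.
move=> ->.
have mS : measurable_fun setT (fun w => \sum_(i < n)
    b (widen_ord (leqnSn n) i) * X (widen_ord (leqnSn n) i) w + a).
  apply: measurable_funD; last exact: measurable_cst.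
  by apply: measurable_sum => i; exact: measurable_funZ.
rewrite (_ : \int[P]_w _ = \int[P]_w (expR (- (b ord_max ^+ 2 * v / 2)) *
    cos (\sum_(i < n) b (widen_ord (leqnSn n) i) * X (widen_ord (leqnSn n) i) w + a))); last first.
  apply: eq_Rintegral => w _; rewrite /F /= -(HX ord_max (b ord_max)).
  apply: eq_Rintegral => w' _; rewrite tnth_mktuple.
  by under eq_bigr do rewrite tnth_mktuple.
rewrite RintE_Z; last exact: bmeas_cos.
rewrite (IH _ (mutually_indep_widen iX) (fun i => HX _)).
by rewrite mulrA -expRD -opprD big_ord_recr/= [X in - X]addrC.
Qed.

Lemma laplace_sum (l psi : R) (n : nat) (X : 'I_n -> T -> R) : 0 <= l ->
  mutually_indep P X ->
  (forall i, \int[P]_w expR (- (l * X i w ^+ 2)) = psi) ->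
  \int[P]_w expR (- (\sum_(i < n) l * X i w ^+ 2)) = psi ^+ n.
Proof.
move=> l0; elim: n X => [|n IH] X iX HX.
  rewrite expr0 -[RHS](RintE_cst P).
  by apply: eq_Rintegral => w _; rewrite big_ord0 oppr0 expR0.
have [mX _] := iX.
have lx0 (x : R) : 0 <= l * x ^+ 2 by rewrite mulr_ge0// sqr_ge0.
pose F (p : n.-tuple R * 1.-tuple R) :=
  expR (- (\sum_(i < n) l * tnth p.1 i ^+ 2)) * expR (- (l * tnth p.2 ord0 ^+ 2)).
have b1 : bmeas (fun t : n.-tuple R => expR (- (\sum_(i < n) l * tnth t i ^+ 2))).
  apply: bmeas_expRN => [|t]; last by apply: sumr_ge0.
  apply: measurable_sum => i; apply: measurable_funZ; apply: measurable_funX.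
  exact: measurable_tnth.
have b2 : bmeas (fun t : 1.-tuple R => expR (- (l * tnth t ord0 ^+ 2))).
  apply: bmeas_expRN => // ; apply: measurable_funZ; apply: measurable_funX.
  exact: measurable_tnth.
have bF : bmeas F := bmeasM (bmeas_comp measurable_fst b1) (bmeas_comp measurable_snd b2).
have iL := mutually_indep_last iX.
have mt1 : measurable_fun setT (tup (fun i : 'I_n => X (widen_ord (leqnSn n) i))).
  by apply: measurable_tup.
have mt2 : measurable_fun setT (tup (fun _ : 'I_1 => X ord_max)) by apply: measurable_tup.
have := indep_Rintegral mt1 mt2 iL bF.
rewrite (_ : \int[P]_w _ = \int[P]_w expR (- (\sum_(i < n.+1) l * X i w ^+ 2))); last first.
  apply: eq_Rintegral => w _; rewrite /F /= tnth_mktuple big_ord_recr/= opprD expRD.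
  by under eq_bigr do rewrite tnth_mktuple.
move=> ->.
rewrite (_ : \int[P]_w _ = \int[P]_w (psi *
    expR (- (\sum_(i < n) l * X (widen_ord (leqnSn n) i) w ^+ 2)))); last first.
  apply: eq_Rintegral => w _; rewrite /F /= mulrC -(HX ord_max) -RintE_Z; last first.
    by apply: bmeas_expRN => //; apply: measurable_funZ; exact: measurable_funX.
  apply: eq_Rintegral => w' _; rewrite tnth_mktuple.
  by under eq_bigr do rewrite tnth_mktuple.
rewrite RintE_Z; last first.
  apply: bmeas_expRN => [|w]; last by apply: sumr_ge0.
  by apply: measurable_sum => i; apply: measurable_funZ; exact: measurable_funX.
by rewrite (IH _ (mutually_indep_widen iX) (fun i => HX _)) exprS.
Qed.

End GaussianVariables.

(** * Regression decomposition of bivariate normal errors *)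

Section BivariateNormal.
Context {R : realType} {d} {T : measurableType d}.
Variable P : probability T R.

Lemma bvn_cf (X Y : T -> R) (v11 v12 v22 : R) :
  measurable_fun setT X -> measurable_fun setT Y ->
  (forall t1 t2, 0 <= qform2 v11 v12 v22 t1 t2) ->
  is_gauss2 (fun S => P ((fun w => (X w, Y w)) @^-1` S)) v11 v12 v22 ->
  forall a b c, \int[P]_w cos (a * X w + b * Y w + c) =
    expR (- (qform2 v11 v12 v22 a b / 2)) * cos c.
Proof.
move=> mX mY q0 HG a b c.
have mL : measurable_fun setT (fun w => a * X w + b * Y w).
  exact: (measurable_funD (measurable_funZ a mX) (measurable_funZ b mY)).
have := gauss1_cf mL (q0 a b) (HG a b) 1 c.
rewrite expr1n mul1r => <-.
by apply: eq_Rintegral => w _; rewrite mul1r.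
Qed.

Lemma bigcap_setI_ord (n : nat) (A B : 'I_n -> set T) :
  \bigcap_(i in [set: 'I_n]) (A i `&` B i) =
  \bigcap_(i in [set: 'I_n]) A i `&` \bigcap_(i in [set: 'I_n]) B i.
Proof.
apply/seteqP; split => w.
  by move=> h; split => i _; have [] := h i I.
by move=> [h1 h2] i _; split; [exact: h1|exact: h2].
Qed.

Section Residual.
Variables (s1 s2 dl : R).
Hypotheses (s10 : 0 < s1) (s20 : 0 < s2) (dl1 : -1 < dl) (dl2 : dl < 1).
Let rho := dl * s2 / s1.
Let tau2 := s2 ^+ 2 * (1 - dl ^+ 2).

(** The left side is the variance of a X + b (Y - rho X). The cross term vanishes because [rho] is
    the regression coefficient of [Y] on [X]; [tau2] is the residual variance. *)
Lemma qform2_residual (a b : R) :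
  qform2 (s1 ^+ 2) (dl * s1 * s2) (s2 ^+ 2) (a - b * rho) b =
  a ^+ 2 * s1 ^+ 2 + b ^+ 2 * tau2.
Proof. by rewrite /qform2 /rho /tau2; field; rewrite gt_eqF. Qed.

Lemma tau2_gt0 : 0 < tau2.
Proof.
rewrite mulr_gt0 ?exprn_gt0// (_ : 1 - dl ^+ 2 = (1 - dl) * (1 + dl)); last by ring.
by rewrite mulr_gt0 ?subr_gt0// -ltrBlDl sub0r.
Qed.

Lemma qform2_ge0 (a b : R) : 0 <= qform2 (s1 ^+ 2) (dl * s1 * s2) (s2 ^+ 2) a b.
Proof.
rewrite -[a](_ : (a + b * rho) - b * rho = a) ?qform2_residual; last by rewrite addrK.
by rewrite addr_ge0// mulr_ge0 ?sqr_ge0// ltW// tau2_gt0.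
Qed.

Variables (n : nat) (X Y : 'I_n -> T -> R).
Hypothesis HXY : iid_bvn P X Y s1 s2 dl.
Let W i w := Y i w - rho * X i w.

Let mX i : measurable_fun setT (X i). Proof. by have [/(_ i)[]] := HXY. Qed.
Let mY i : measurable_fun setT (Y i). Proof. by have [/(_ i)[]] := HXY. Qed.
Let mW i : measurable_fun setT (W i).
Proof. exact: (measurable_funB (mY i) (measurable_funZ rho (mX i))). Qed.

Lemma bvn_residual_cf i a b c : \int[P]_w cos (a * X i w + b * W i w + c) =
  expR (- ((a ^+ 2 * s1 ^+ 2 + b ^+ 2 * tau2) / 2)) * cos c.
Proof.
have [_ [HG _]] := HXY.
rewrite -qform2_residual -(bvn_cf (mX i) (mY i) qform2_ge0 (HG i)).
by apply: eq_Rintegral => w _; congr cos; rewrite /W; ring.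
Qed.

Lemma bvn_first_cf i b a :
  \int[P]_w cos (b * X i w + a) = expR (- (b ^+ 2 * s1 ^+ 2 / 2)) * cos a.
Proof.
have := bvn_residual_cf i b 0 a; rewrite expr0n/= mul0r addr0 => <-.
by apply: eq_Rintegral => w _; rewrite mul0r addr0.
Qed.

Lemma bvn_second_cf i b a :
  \int[P]_w cos (b * W i w + a) = expR (- (b ^+ 2 * tau2 / 2)) * cos a.
Proof.
have := bvn_residual_cf i 0 b a; rewrite expr0n/= mul0r add0r => <-.
by apply: eq_Rintegral => w _; rewrite mul0r add0r.
Qed.

Lemma bvn_first_law i A : measurable A -> P (X i @^-1` A) = gauss1 (s1 ^+ 2) A.
Proof.
move=> mA; have [_ [HG _]] := HXY; have := HG i 1 0 A mA.
rewrite (_ : qform2 _ _ _ _ _ = s1 ^+ 2); last by rewrite /qform2; ring.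
move=> <-; congr (P _); apply/seteqP; split => w /=; by rewrite mul1r mul0r addr0.
Qed.

(** The variance of a X + b W has no cross term, so the joint characteristic function factorises. *)
Lemma bvn_residual_indep i : indep P (X i) (W i).
Proof.
apply: indep_of_cf => // a b c.
rewrite bvn_residual_cf.
transitivity (\int[P]_w (expR (- (b ^+ 2 * tau2 / 2)) * cos (a * X i w + c))); last first.
  apply: eq_Rintegral => w _; rewrite -(bvn_second_cf i).
  by apply: eq_Rintegral => w' _; congr cos; ring.
rewrite RintE_Z; last first.
  by apply: bmeas_cos; apply: measurable_funD; [exact: measurable_funZ|exact: measurable_cst].
by rewrite bvn_first_cf mulrA -expRD; congr (expR _ * _); field.
Qed.

(** A condition on [(X i, W i)] is a condition [D i] on the pair [(X i, Y i)]. Independence across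
    [i] gives the product; independence within each pair splits every factor. *)
Lemma bvn_rect (A B : 'I_n -> set R) :
  (forall i, measurable (A i)) -> (forall i, measurable (B i)) ->
  P (\bigcap_(i in [set: 'I_n]) (X i @^-1` A i) `&`
     \bigcap_(i in [set: 'I_n]) (W i @^-1` B i)) =
  (\prod_(i < n) (P (X i @^-1` A i) * P (W i @^-1` B i)))%E.
Proof.
move=> mA mB; have [_ [_ HI]] := HXY.
pose D i : set (R * R) := (fst @^-1` A i) `&` ((fun z : R * R => z.2 - rho * z.1) @^-1` B i).
have mD i : measurable (D i).
  apply: measurableI; first exact: (measurable_pre measurable_fst (mA i)).
  exact: (measurable_pre (measurable_funB measurable_snd (measurable_funZ rho measurable_fst))
    (mB i)).
rewrite -bigcap_setI_ord.
transitivity (P (\bigcap_(i in [set: 'I_n]) ((fun w => (X i w, Y i w)) @^-1` D i))).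
  by congr (P _).
rewrite (HI D mD); apply: eq_bigr => i _.
exact (@bvn_residual_indep i (A i) (B i) (mA i) (mB i)).
Qed.

Lemma bvn_first_mutually_indep : mutually_indep P X.
Proof.
split=> // A mA; have := bvn_rect mA (fun=> measurableT).
rewrite (_ : \bigcap_(i in _) (W i @^-1` setT) = setT); last first.
  by rewrite -subTset => w _ i _.
rewrite setIT => ->; apply: eq_bigr => i _.
by rewrite preimage_setT probability_setT mule1.
Qed.

Lemma bvn_second_mutually_indep : mutually_indep P W.
Proof.
split=> // B mB; have := bvn_rect (fun=> measurableT) mB.
rewrite (_ : \bigcap_(i in _) (X i @^-1` setT) = setT); last first.
  by rewrite -subTset => w _ i _.
rewrite setTI => ->; apply: eq_bigr => i _.
by rewrite preimage_setT probability_setT mul1e.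
Qed.

Lemma bvn_tup_indep : indep P (tup X) (tup W).
Proof.
apply: indep_tup => // A B mA mB.
rewrite bvn_rect// big_split/=; congr (_ * _)%E.
  by have [_ ->] := bvn_first_mutually_indep.
by have [_ ->] := bvn_second_mutually_indep.
Qed.

End Residual.
End BivariateNormal.

(** * Algebra of the estimators for a fixed vector of first errors *)

Section Algebra.
Context {R : realType} (n : nat).
Implicit Types z e w : 'I_n -> R.

Lemma dotvC z e : dotv z e = dotv e z.
Proof. by apply: eq_bigr => i _; rewrite mulrC. Qed.

(* The coefficient of [R_i] in the least-squares estimator of the direct effect
   in the regression of [R] on [(Z, M)], when [M = z A + e]; it is [0] by
   convention if the design is singular. *)
Definition ols_coef (A : R) z e (i : 'I_n) : R :=
  let M i := z i * A + e i in
  (dotv M M * z i - dotv z M * M i) / (dotv z z * dotv M M - dotv z M ^+ 2).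

Variables (A : R) (z e : 'I_n -> R).
Let M i := z i * A + e i.

Lemma dotv_zM : dotv z M = A * dotv z z + dotv z e.
Proof. by rewrite /dotv mulr_sumr -big_split; apply: eq_bigr => i _ /=; rewrite /M; ring. Qed.

Lemma dotv_MM : dotv M M = A ^+ 2 * dotv z z + 2 * A * dotv z e + dotv e e.
Proof.
by rewrite /dotv !mulr_sumr -!big_split; apply: eq_bigr => i _ /=; rewrite /M; ring.
Qed.

Lemma dotv_Mw w : dotv M w = A * dotv z w + dotv e w.
Proof. by rewrite /dotv mulr_sumr -big_split; apply: eq_bigr => i _ /=; rewrite /M; ring. Qed.

(** A Gram determinant does not change when a multiple of [z] is added to [e]; singularity is thus a
    matter of [z] and [e] alone. *)
Lemma ols_det : dotv z z * dotv M M - dotv z M ^+ 2 =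
  dotv z z * dotv e e - dotv z e ^+ 2.
Proof. by rewrite dotv_zM dotv_MM; ring. Qed.

Lemma ols_coef_dotv w : \sum_(i < n) ols_coef A z e i * w i =
  (dotv M M * dotv z w - dotv z M * dotv M w) / (dotv z z * dotv e e - dotv z e ^+ 2).
Proof.
rewrite -ols_det; set D := _ - _ ^+ 2; set mm := dotv M M; set zm := dotv z M.
rewrite (_ : mm * _ - _ = \sum_(i < n) (mm * z i - zm * M i) * w i); last first.
  by rewrite /dotv !mulr_sumr -sumrB; apply: eq_bigr => i _; ring.
rewrite mulr_suml; apply: eq_bigr => i _.
by rewrite /ols_coef -/M -/mm -/zm -/D mulrAC.
Qed.

(** The coefficient vector has product 1 with [z] and 0 with [M]. This gives the cross term 2 a b,
    and M.M divided by the determinant for its squared norm. *)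
Lemma ols_coef_sum_sqr (a b : R) : dotv z z * dotv e e - dotv z e ^+ 2 != 0 ->
  dotv z z != 0 ->
  \sum_(i < n) (a * z i + b * ols_coef A z e i) ^+ 2 =
  a ^+ 2 * dotv z z + 2 * a * b +
  b ^+ 2 * (A ^+ 2 * dotv z z + 2 * A * dotv z e + dotv e e)
    / (dotv z z * dotv e e - dotv z e ^+ 2).
Proof.
move=> D0 z0.
have -> : \sum_(i < n) (a * z i + b * ols_coef A z e i) ^+ 2 =
    a ^+ 2 * dotv z z + (2 * a * b) * (\sum_(i < n) ols_coef A z e i * z i)
    + b ^+ 2 * (\sum_(i < n) ols_coef A z e i * ols_coef A z e i).
  rewrite /dotv !mulr_sumr -!big_split; apply: eq_bigr => i _; rewrite [RHS]/=.
  by move: (ols_coef A z e i) => o; ring.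
rewrite !ols_coef_dotv.
rewrite [dotv z (ols_coef _ _ _)]dotvC [dotv M (ols_coef _ _ _)]dotvC.
rewrite [dotv (ols_coef _ _ _) z]ols_coef_dotv [dotv (ols_coef _ _ _) M]ols_coef_dotv.
rewrite [dotv M z]dotvC -/M !dotv_zM !dotv_MM.
by field.
Qed.

Variables (rho B C : R) (w : 'I_n -> R).
Let Rv i := z i * C + M i * B + (rho * e i + w i).

Lemma total_effect_error : dotv z z != 0 ->
  dotv z Rv / dotv z z - (C + A * B) = ((B + rho) * dotv z e + dotv z w) / dotv z z.
Proof.
move=> z0.
have -> : dotv z Rv = C * dotv z z + B * dotv z M + (rho * dotv z e + dotv z w).
  by rewrite /dotv !mulr_sumr -!big_split; apply: eq_bigr => i _ /=; rewrite /Rv; ring.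
by rewrite dotv_zM; field.
Qed.

(** Least squares removes the [B] term and reproduces [C]. As e = M - A z, the coefficients have
    product - A with [e], which biases least squares by - A rho. The correction rho Z.M / Z.Z equals
    rho A + rho Z.e / Z.Z and cancels this bias. *)
Lemma direct_effect_error : dotv z z * dotv e e - dotv z e ^+ 2 != 0 ->
  dotv z z != 0 ->
  (dotv M M * dotv z Rv - dotv z M * dotv M Rv)
    / (dotv z z * dotv M M - dotv z M ^+ 2) + rho * dotv z M / dotv z z - C =
  \sum_(i < n) ols_coef A z e i * w i + rho * dotv z e / dotv z z.
Proof.
move=> D0 z0; rewrite ols_coef_dotv ols_det.
have -> : dotv z Rv = C * dotv z z + B * dotv z M + (rho * dotv z e + dotv z w).
  by rewrite /dotv !mulr_sumr -!big_split; apply: eq_bigr => i _ /=; rewrite /Rv; ring.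
have -> : dotv M Rv = C * dotv z M + B * dotv M M + (rho * dotv M e + dotv M w).
  by rewrite /dotv !mulr_sumr -!big_split; apply: eq_bigr => i _ /=; rewrite /Rv; ring.
rewrite dotv_MM dotv_zM !dotv_Mw; field.
by rewrite D0 z0.
Qed.

End Algebra.

(** * Limits and explicit bounds *)

Section Limits.
Context {R : realType}.

Lemma cvg_expR_comp {I : Type} {F : set_system I} {FF : Filter F} (f : I -> R) (l : R) :
  f i @[i --> F] --> l -> expR (f i) @[i --> F] --> expR l.
Proof.
by move=> h; exact: (@cvg_comp _ _ _ f expR F (nbhs l) _ h (@continuous_expR R l)).
Qed.

(** Squeeze with y = 2 x / n, after squaring: 1 + y <= exp y bounds the power below by exp (- x),
    and 1 / (1 + y) = 1 - y / (1 + y) <= exp (- y / (1 + y)) bounds it above by exp (- x / (1 +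
    y)). *)
Lemma cvg_normalised_laplace (x : R) : 0 <= x ->
  (Num.sqrt (1 + 2 * (x / n%:R)))^-1 ^+ n @[n --> \oo] --> expR (- x).
Proof.
move=> x0.
apply: (@squeeze_cvgr _ _ _ _ (cst (expR (- x)))
  (fun n : nat => expR (- (x / (1 + 2 * (x * n%:R^-1)))))).
- near=> n.
  have n0 : 0 < n%:R :> R by rewrite ltr0n; near: n; exact: nbhs_infty_gt.
  set y := 2 * (x / n%:R).
  have y0 : 0 <= y by rewrite mulr_ge0// divr_ge0// ltW.
  have y1 : 0 < 1 + y by rewrite ltr_pwDl.
  have r0 : 0 < Num.sqrt (1 + y) by rewrite sqrtr_gt0.
  have root_le (u v : R) : 0 <= v -> u ^+ 2 <= v ^+ 2 -> u <= v.
    by move=> v0; apply: contraTT; rewrite -!ltNge => uv; rewrite ltrXn2r// ?nnegrE// ltW// (le_lt_trans v0).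
  have E : ((Num.sqrt (1 + y))^-1 ^+ n) ^+ 2 = ((1 + y) ^+ n)^-1.
    by rewrite exprAC exprVn sqr_sqrtr ?(ltW y1)// exprVn.
  have ny : y * n%:R = 2 * x by rewrite /y; field; rewrite gt_eqF.
  apply/andP; split; apply: root_le.
  + by rewrite exprn_ge0// invr_ge0 ltW.
  + rewrite E -expRM_natr /cst mulNr expRN lef_pV2 ?posrE ?expR_gt0 ?exprn_gt0//.
    rewrite (_ : x * 2 = y * n%:R); last by rewrite ny mulrC.
    by rewrite expRM_natr lerXn2r ?nnegrE ?expR_ge0 ?(ltW y1)// expR_ge1Dx.
  + exact: expR_ge0.
  + rewrite E -expRM_natr mulNr expRN lef_pV2 ?posrE ?expR_gt0 ?exprn_gt0// -/y.
    rewrite (_ : x / _ * 2 = y / (1 + y) * n%:R); last first.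
      by rewrite [RHS]mulrAC ny [LHS]mulrAC (mulrC x).
    rewrite expRM_natr lerXn2r ?nnegrE ?expR_ge0 ?(ltW y1)//.
    rewrite -[expR _]invrK -expRN -[leRHS]invrK lef_pV2 ?posrE ?invr_gt0 ?expR_gt0//.
    rewrite [leLHS](_ : _ = 1 + - (y / (1 + y))); last by field; rewrite gt_eqF.
    exact: expR_ge1Dx.
- exact: cvg_cst.
- apply: cvg_expR_comp.
  have cd : 1 + 2 * (x * n%:R^-1) @[n --> \oo] --> (1 : R).
    rewrite -[X in _ --> X]addr0; apply: cvgD; first exact: cvg_cst.
    rewrite -[X in _ --> X](mulr0 2); apply: cvgM; first exact: cvg_cst.
    rewrite -[X in _ --> X](mulr0 x); apply: cvgM; first exact: cvg_cst.
    apply/gtr0_cvgV0; last exact: cvgr_idn.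
    by near=> n; rewrite ltr0n; near: n; exact: nbhs_infty_gt.
  rewrite (_ : - x = - (x * 1^-1)); last by rewrite invr1 mulr1.
  apply: cvgN; apply: cvgM; first exact: cvg_cst.
  by apply: cvgV; [exact: oner_neq0|exact: cd].
Unshelve. all: end_near. Qed.

(** Continuity at [(q, 0, s)], where the determinant z v - u^2 is q s > 0. The radius [dt] is a
    fixed number, so the estimate will hold at every sample point at which the three averages are
    close to their limits. *)
Lemma conditional_cf_near (tau2 q s A t1 t2 : R) : 0 < q -> 0 < s ->
  forall eta, 0 < eta -> exists2 dt, 0 < dt & forall z u v : R,
    `|z - q| < dt -> `|u| < dt -> `|v - s| < dt ->
    0 < z * v - u ^+ 2 /\
    `|expR (- (tau2 / 2 * ((t1 ^+ 2 + 2 * t1 * t2) / z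
         + t2 ^+ 2 * (A ^+ 2 * z + 2 * A * u + v) / (z * v - u ^+ 2)))) -
      expR (- (tau2 / 2 * ((t1 ^+ 2 + 2 * t1 * t2) / q
         + t2 ^+ 2 * (A ^+ 2 * q + s) / (q * s))))| <= eta.
Proof.
move=> q0 s0 eta eta0.
pose p0 : R * (R * R) := (q, (0, s)).
have cz : p.1 @[p --> p0] --> q by exact: cvg_fst.
have c2 : p.2 @[p --> p0] --> (0 : R, s) by exact: cvg_snd.
have cu : p.2.1 @[p --> p0] --> (0 : R).
  by apply: (cvg_comp _ _ c2); exact: cvg_fst.
have cv : p.2.2 @[p --> p0] --> s.
  by apply: (cvg_comp _ _ c2); exact: cvg_snd.
have cD : p.1 * p.2.2 - p.2.1 ^+ 2 @[p --> p0] --> q * s.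
  rewrite -[X in _ --> X]subr0 -[X in _ - X](mulr0 0).
  by under eq_fun do rewrite expr2; apply: cvgB; exact: cvgM.
have D0 : 0 < q * s by rewrite mulr_gt0.
have near1 : \forall p \near p0, 0 < p.1 * p.2.2 - p.2.1 ^+ 2.
  by apply: (cvgr_gt _ cD).
have near2 : expR (- (tau2 / 2 * ((t1 ^+ 2 + 2 * t1 * t2) / p.1
         + t2 ^+ 2 * (A ^+ 2 * p.1 + 2 * A * p.2.1 + p.2.2) / (p.1 * p.2.2 - p.2.1 ^+ 2))))
     @[p --> p0] -->
     expR (- (tau2 / 2 * ((t1 ^+ 2 + 2 * t1 * t2) / q
         + t2 ^+ 2 * (A ^+ 2 * q + s) / (q * s)))).
  apply: cvg_expR_comp.
  apply: cvgN; apply: cvgM; first exact: cvg_cst.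
  apply: cvgD.
    by apply: cvgM; [exact: cvg_cst|apply: cvgV => //; rewrite gt_eqF].
  apply: cvgM; last by apply: cvgV => //; rewrite gt_eqF.
  apply: cvgM; first exact: cvg_cst.
  apply: cvgD => //; rewrite -[X in _ --> X]addr0 -(mulr0 (2 * A)).
  by apply: cvgD; apply: cvgM => //; exact: cvg_cst.
move/cvgrPdist_le/(_ _ eta0) : near2 => near2.
have /nbhs_ballP[dt /= dt0 H] := @filterI _ _ (nbhs_filter p0) _ _ near1 near2.
exists dt => // z u v hz hu hv.
have /H[] : ball p0 dt (z, (u, v)).
  by split; [|split]; rewrite /ball/= distrC// subr0.
by move=> h1 h2; split => //; rewrite distrC.
Qed.

(** This lower bound off a neighbourhood of [(0, s)] is what a Markov inequality requires. The
    average [v] enters through exp (- v), for which the mean square deviation is made of Laplace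
    transforms. *)
Lemma deviation_lower_bound (s dt : R) : 0 < dt -> exists2 c, 0 < c &
  forall u v : R, dt <= `|u| \/ dt <= `|v - s| ->
    c <= Num.min 1 `|u| + (expR (- v) - expR (- s)) ^+ 2.
Proof.
move=> dt0.
(* The gap between exp (- v) and exp (- s) at v = s + dt. At v = s - dt it is at least as large,
   because exp dt + exp (- dt) >= 2. *)
pose m := expR (- s) * (1 - expR (- dt)).
have m0 : 0 < m by rewrite mulr_gt0 ?expR_gt0// subr_gt0 -[ltRHS]expR0 ltr_expR oppr_lt0.
exists (Num.min (Num.min 1 dt) (m ^+ 2)).
  by rewrite !lt_min ltr01 dt0 exprn_gt0.
move=> u v; have mu0 : 0 <= Num.min 1 `|u| by rewrite le_min ler01 normr_ge0.
case=> h.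
  rewrite (@le_trans _ _ (Num.min 1 dt))//; first by rewrite ge_min lexx.
  rewrite (@le_trans _ _ (Num.min 1 `|u|))// ?lerDl ?sqr_ge0//.
  by rewrite le_min !ge_min lexx h orbT.
rewrite (@le_trans _ _ (m ^+ 2))//; first by rewrite ge_min lexx orbT.
rewrite ler_wpDl// -(real_normK (num_real (expR (- v) - expR (- s)))) lerXn2r ?nnegrE ?(ltW m0)//.
have ev (t : R) : expR (- (s + t)) = expR (- s) * expR (- t) by rewrite opprD expRD.
move: h; rewrite ler_normr => /orP[h|h].
  rewrite distrC (le_trans _ (ler_norm _))// /m mulrBr mulr1 -ev lerD2l lerN2 ler_expR lerN2.
  by rewrite -lerBrDl.
rewrite (le_trans _ (ler_norm _))//.
have : expR (- s) * expR dt <= expR (- v).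
  by rewrite -expRD ler_expR; move: h; lra.
have e1 := expR_ge1Dx dt; have e2 := expR_ge1Dx (- dt).
have es := expR_gt0 (- s); rewrite /m.
have : 2 <= expR dt + expR (- dt) by move: e1 e2; lra.
by move: (expR (- s)) (expR dt) (expR (- dt)) (expR (- v)) es {ev m m0 e1 e2} => a b c w; nra.
Qed.

Lemma continuous_min1_norm : continuous (fun u : R => Num.min 1 `|u|).
Proof.
move=> u.
have c1 : {for u, continuous (cst 1 : R -> R^o)} by exact: cst_continuous.
have h : {for u, continuous (fun u : R => `|u| : R^o)} by exact: norm_continuous.
by have := continuous_min c1 h.
Qed.

End Limits.

(** * Existence of the limit law *)

Section GaussianLawExistence.
Context {R : realType} {d} {T : measurableType d}.
Variables (P : probability T R) (X Y : 'I_1 -> T -> R) (s1 s2 dl : R).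
Hypotheses (s10 : 0 < s1) (s20 : 0 < s2) (dl1 : -1 < dl) (dl2 : dl < 1).
Hypothesis HXY : iid_bvn P X Y s1 s2 dl.

(* The limit law is realised, by a Cholesky factorisation, as a linear image of
   one of the given pairs of errors. *)
Lemma gauss2_realisation (v11 v12 v22 : R) : 0 < v11 -> v12 ^+ 2 <= v11 * v22 ->
  exists2 V : T -> R * R, measurable_fun setT V &
    is_gauss2 (fun S => P (V @^-1` S)) v11 v12 v22.
Proof.
move=> v110 hv.
have [/(_ ord0)[mX mY] [HG _]] := HXY.
pose tau2 := s2 ^+ 2 * (1 - dl ^+ 2); have tau20 : 0 < tau2 by exact: tau2_gt0.
pose rho := dl * s2 / s1.
(* [l11], [l21], [l22] form the lower triangular Cholesky factor. It is applied to the independent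
   standard normal variables X / s1 and (Y - rho X) / tau. *)
pose l11 := Num.sqrt v11; pose l21 := v12 / l11.
pose l22 := Num.sqrt (v22 - v12 ^+ 2 / v11); pose tau := Num.sqrt tau2.
have l110 : 0 < l11 by rewrite sqrtr_gt0.
have tau0 : 0 < tau by rewrite sqrtr_gt0.
have l11E : l11 ^+ 2 = v11 by rewrite sqr_sqrtr// ltW.
have tauE : tau ^+ 2 = tau2 by rewrite sqr_sqrtr// ltW.
have l22E : l22 ^+ 2 = v22 - v12 ^+ 2 / v11.
  by rewrite sqr_sqrtr// subr_ge0 ler_pdivrMr// mulrC.
pose V w := (l11 / s1 * X ord0 w,
  (l21 / s1 - rho * l22 / tau) * X ord0 w + l22 / tau * Y ord0 w).
exists V.
  apply: measurable_fun_pair; first exact: measurable_funZ.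
  by apply: measurable_funD; exact: measurable_funZ.
move=> t1 t2 D mD.
(* The coefficients of [X] and of the residual Y - rho X in t1 V.1 + t2 V.2. *)
pose a := (t1 * l11 + t2 * l21) / s1; pose b := t2 * l22 / tau.
have -> : qform2 v11 v12 v22 t1 t2 =
    qform2 (s1 ^+ 2) (dl * s1 * s2) (s2 ^+ 2) (a - b * rho) b.
  rewrite (qform2_residual s2 dl s10 a b) -/tau2.
  have -> : a ^+ 2 * s1 ^+ 2 = (t1 * l11 + t2 * l21) ^+ 2.
    by rewrite /a; field; rewrite gt_eqF.
  have -> : b ^+ 2 * tau2 = t2 ^+ 2 * (v22 - v12 ^+ 2 / v11).
    by rewrite -l22E -tauE /b; field; rewrite gt_eqF.
  have -> : (t1 * l11 + t2 * l21) ^+ 2 =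
      t1 ^+ 2 * l11 ^+ 2 + 2 * t1 * t2 * v12 + t2 ^+ 2 * (v12 ^+ 2 / l11 ^+ 2).
    by rewrite /l21; field; rewrite gt_eqF.
  by rewrite l11E /qform2; field; rewrite gt_eqF.
rewrite -(HG ord0 _ _ _ mD); congr (P _); apply/seteqP.
have E w : (a - b * rho) * X ord0 w + b * Y ord0 w = t1 * (V w).1 + t2 * (V w).2.
  by rewrite /a /b /V /=; field; rewrite !gt_eqF.
by split => w /=; rewrite ?E// -E.
Qed.

End GaussianLawExistence.

(** * The mediation model: limit of the characteristic functions and conclusion *)

Section Mediation.
Context {R : realType}.

Lemma measurable_dotv {d'} {S : measurableType d'} (n : nat) (f g : 'I_n -> S -> R) :
  (forall i, measurable_fun setT (f i)) -> (forall i, measurable_fun setT (g i)) ->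
  measurable_fun setT (fun s => dotv (fun i => f i s) (fun i => g i s)).
Proof. by move=> mf mg; apply: measurable_sum => i; exact: measurable_funM. Qed.

Lemma measurable_ols_coef {d'} {S : measurableType d'} (n : nat) (A : R) (z : 'I_n -> R)
    (f : 'I_n -> S -> R) (i : 'I_n) : (forall i, measurable_fun setT (f i)) ->
  measurable_fun setT (fun s => ols_coef A z (fun i => f i s) i).
Proof.
move=> mf; have mM j : measurable_fun setT (fun s => z j * A + f j s).
  by apply: measurable_funD => //; exact: measurable_cst.
have mz j : measurable_fun setT (fun s : S => z j) by exact: measurable_cst.
have mMM := measurable_dotv mM mM; have mzM := measurable_dotv mz mM.
apply: measurable_funM.
  apply: measurable_funB; first exact: measurable_funM.
  exact: measurable_funM.
apply: measurable_funV; apply: measurable_funB; first exact: measurable_funZ.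
exact: measurable_funX.
Qed.

Context {d : measure_display} {T : measurableType d}.
Unset Implicit Arguments.
Variables (P : probability T R) (Z : forall n : nat, 'I_n -> R)
  (E1 E2 M Rv : forall n : nat, 'I_n -> T -> R) (A B C s1 s2 dl q : R).
Hypotheses (s10 : 0 < s1) (s20 : 0 < s2) (dl1 : -1 < dl) (dl2 : dl < 1) (q0 : 0 < q).
Hypothesis cvgZ : (fun n : nat => dotv (Z n) (Z n) / n%:R) @ \oo --> q.
Hypothesis HE : forall n, iid_bvn P (E1 n) (E2 n) s1 s2 dl.
Hypothesis HM : forall n i w, M n i w = Z n i * A + E1 n i w.
Hypothesis HR : forall n i w, Rv n i w = Z n i * C + M n i w * B + E2 n i w.

Let rho := dl * s2 / s1.
Let tau2 := s2 ^+ 2 * (1 - dl ^+ 2).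
Let W n (i : 'I_n) w := E2 n i w - rho * E1 n i w.
Let zn n := dotv (Z n) (Z n) / n%:R.
Let un n w := dotv (Z n) (fun i => E1 n i w) / n%:R.
Let vn n w := dotv (fun i => E1 n i w) (fun i => E1 n i w) / n%:R.
Let dev n w := Num.min 1 `|un n w| + (expR (- vn n w) - expR (- s1 ^+ 2)) ^+ 2.

Set Implicit Arguments.

Let mE1 n i : measurable_fun setT (E1 n i).
Proof. by have [/(_ i)[]] := HE n. Qed.
Let mE2 n i : measurable_fun setT (E2 n i).
Proof. by have [/(_ i)[]] := HE n. Qed.
Let mW n i : measurable_fun setT (W n i).
Proof. exact: (measurable_funB (@mE2 n i) (measurable_funZ rho (@mE1 n i))). Qed.

Let mun n : measurable_fun setT (un n).
Proof.
apply: measurable_funM; last exact: measurable_cst.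
by apply: measurable_dotv => // i; exact: measurable_cst.
Qed.

Let mvn n : measurable_fun setT (vn n).
Proof. by apply: measurable_funM; [exact: measurable_dotv|exact: measurable_cst]. Qed.

Let vn_ge0 n w : 0 <= vn n w.
Proof. by rewrite divr_ge0// sumr_ge0// => i _; rewrite -expr2 sqr_ge0. Qed.

Lemma cvgn_inv : n%:R^-1 @[n --> \oo] --> (0 : R).
Proof.
apply/gtr0_cvgV0; last exact: cvgr_idn.
by near=> n; rewrite ltr0n; near: n; exact: nbhs_infty_gt.
Unshelve. all: end_near. Qed.

Let cf_linear n (c a : R) :
  \int[P]_w cos (c * dotv (Z n) (fun i => E1 n i w) + a) =
  expR (- (c ^+ 2 * dotv (Z n) (Z n) * s1 ^+ 2 / 2)) * cos a.
Proof.
have := cf_sum (bvn_first_mutually_indep s10 s20 dl1 dl2 (HE n))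
  (bvn_first_cf s10 s20 dl1 dl2 (HE n)) (fun i => c * Z n i) a.
rewrite (_ : \sum_(i < n) _ = c ^+ 2 * dotv (Z n) (Z n) * s1 ^+ 2 / 2); last first.
  by rewrite /dotv mulr_sumr !mulr_suml; apply: eq_bigr => i _; ring.
move=> <-; apply: eq_Rintegral => w _; rewrite /dotv mulr_sumr.
by congr (cos (_ + _)); apply: eq_bigr => i _; rewrite mulrA.
Qed.

Let bmeas_min1 n : bmeas (fun w => Num.min 1 `|un n w|).
Proof.
split; first by apply: measurable_minr => //; exact: measurableT_comp.
by exists 1 => w; rewrite ger0_norm ?ge_min ?lexx// le_min ler01 normr_ge0.
Qed.

(** [un] is centered normal with variance s1^2 zn / n, so its characteristic function tends to 1.
    The continuity theorem is applied with second coordinate 0 and the Dirac mass at the origin as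
    limit. *)
Let cvg_min1 : \int[P]_w Num.min 1 `|un n w| @[n --> \oo] --> (0 : R).
Proof.
pose f (z : R * R) := Num.min 1 `|z.1|.
have cf : continuous f.
  move=> z; apply: (@continuous_comp _ _ _ fst (fun u : R => Num.min 1 `|u|)).
    exact: cvg_fst.
  exact: continuous_min1_norm.
have mX n : measurable_fun setT (fun w => (un n w, 0 : R)).
  by apply: measurable_fun_pair => //; exact: measurable_cst.
have mY : measurable_fun setT (fun w : T => (0 : R, 0 : R)) by exact: measurable_cst.
have H (a b c : R) : \int[P]_w cos (a * (un n w, 0 : R).1 + b * (un n w, 0 : R).2 + c)
    @[n --> \oo] --> \int[P]_w cos (a * (0 : R, 0 : R).1 + b * (0 : R, 0 : R).2 + c).
  rewrite /= RintE_cst !mulr0 !add0r.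
  rewrite [X in X @ _ --> _](_ : _ = fun n : nat =>
      expR (- (a ^+ 2 * s1 ^+ 2 / 2 * (zn n * n%:R^-1))) * cos c); last first.
    apply/funext => n; have := cf_linear n (a / n%:R) c.
    rewrite (_ : (a / n%:R) ^+ 2 * _ * _ / 2 = a ^+ 2 * s1 ^+ 2 / 2 * (zn n * n%:R^-1)).
      by move=> <-; apply: eq_Rintegral => w _; rewrite ?mulr0 addr0 /un mulrA mulrAC.
    by rewrite /zn exprMn exprVn expr2 invfM; ring.
  have h1 : zn n * n%:R^-1 @[n --> \oo] --> (0 : R).
    by rewrite -[X in _ --> X](mulr0 q); apply: cvgM; [exact: cvgZ|exact: cvgn_inv].
  have h2 : a ^+ 2 * s1 ^+ 2 / 2 * (zn n * n%:R^-1) @[n --> \oo] --> (0 : R).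
    rewrite -[X in _ --> X](mulr0 (a ^+ 2 * s1 ^+ 2 / 2)).
    by apply: cvgM; [exact: cvg_cst|exact: h1].
  have h3 := cvg_expR_comp (cvgN h2); rewrite oppr0 expR0 in h3.
  rewrite -[X in _ --> X]mul1r; apply: cvgM; [exact: h3|exact: cvg_cst].
have fb : exists M : R, forall z, `|f z| <= M.
  by exists 1 => z; rewrite ger0_norm ?ge_min ?lexx// le_min ler01 normr_ge0.
have := levy_plane (P := P) (P' := P) mX mY H cf fb.
by rewrite RintE_cst /f /= normr0 (min_idPr _)// ler01.
Qed.

Let bmeas_expv n : bmeas (fun w => expR (- vn n w)).
Proof. by apply: bmeas_expRN. Qed.

Let laplace_v (l : R) : 0 <= l ->
  \int[P]_w expR (- (l * vn n w)) @[n --> \oo] --> expR (- (l * s1 ^+ 2)).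
Proof.
move=> l0; have s2_0 : 0 < s1 ^+ 2 by rewrite exprn_gt0.
have := cvg_normalised_laplace (mulr_ge0 l0 (ltW s2_0)).
rewrite [X in X @ _ --> _ -> _](_ : _ = fun n => \int[P]_w expR (- (l * vn n w)))//.
apply/funext => n.
have ln0 : 0 <= l / n%:R by rewrite divr_ge0.
rewrite (_ : 2 * (l * s1 ^+ 2 / n%:R) = 2 * (l / n%:R) * s1 ^+ 2); last by ring.
rewrite -(laplace_sum (l := l / n%:R) ln0 (bvn_first_mutually_indep s10 s20 dl1 dl2 (HE n))); last first.
  move=> i; apply: gauss1_laplace => //.
  by move=> D mD; exact: (bvn_first_law (HE n)).
apply: eq_Rintegral => w _; congr (expR (- _)).
by rewrite /vn /dotv mulrA mulr_sumr mulr_suml; apply: eq_bigr => i _; ring.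
Qed.

Let bmeas_dev n : bmeas (dev n).
Proof.
have b2 : bmeas (fun w => expR (- vn n w) - expR (- s1 ^+ 2)).
  exact: bmeasB (bmeas_expv n) (bmeas_cst _).
apply: bmeasD => //; rewrite (_ : (fun w => _) = fun w =>
  (expR (- vn n w) - expR (- s1 ^+ 2)) * (expR (- vn n w) - expR (- s1 ^+ 2))).
  exact: (bmeasM b2 b2).
by apply/funext => w; rewrite expr2.
Qed.

(* Convergence in probability of [(un, vn)] to [(0, s1^2)], expressed through the
   expectation of a bounded function; the law of large numbers for [vn] comes from
   the Laplace transform of the chi-squared law. *)
Let cvg_dev : \int[P]_w dev n w @[n --> \oo] --> (0 : R).
Proof.
set m := expR (- s1 ^+ 2).
(* Expanding the square leaves the Laplace transform of [vn] at 2 and at 1; the limit is m^2 - 2 m^2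
   + m^2 = 0. *)
have E n : \int[P]_w dev n w = \int[P]_w Num.min 1 `|un n w| +
    (\int[P]_w expR (- (2 * vn n w)) - 2 * m * \int[P]_w expR (- (1 * vn n w)) + m ^+ 2).
  have b1 : bmeas (fun w => expR (- (2 * vn n w))).
    by apply: bmeas_expRN => [|w]; [exact: measurable_funZ|rewrite mulr_ge0].
  have b2 : bmeas (fun w => expR (- (1 * vn n w))).
    by apply: bmeas_expRN => [|w]; [exact: measurable_funZ|rewrite mulr_ge0].
  have b3 : bmeas (fun w => 2 * m * expR (- (1 * vn n w))).
    by apply: bmeasM => //; exact: bmeas_cst.
  have b4 : bmeas (fun w : T => m ^+ 2) by exact: bmeas_cst.
  rewrite -(RintE_Z P (2 * m) b2) -(RintE_B P b1 b3).
  rewrite -[X in _ + (_ + X)](RintE_cst P) -(RintE_D P (bmeasB b1 b3) b4).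
  rewrite -(RintE_D P (bmeas_min1 n) (bmeasD (bmeasB b1 b3) b4)).
  apply: eq_Rintegral => w _; rewrite /dev -/m mul1r; congr (_ + _).
  by rewrite mulr_natl mulr2n opprD expRD; ring.
rewrite [X in X @ _ --> _](_ : _ = fun n => \int[P]_w Num.min 1 `|un n w| +
    (\int[P]_w expR (- (2 * vn n w)) - 2 * m * \int[P]_w expR (- (1 * vn n w)) + m ^+ 2));
  last by apply/funext => n; exact: E.
have -> : (0 : R) = 0 + (expR (- (2 * s1 ^+ 2)) - 2 * m * expR (- (1 * s1 ^+ 2)) + m ^+ 2).
  by rewrite mul1r -/m mulr_natl mulr2n opprD expRD -/m; ring.
apply: cvgD => //; apply: cvgD; last exact: cvg_cst.
apply: cvgB; first by apply: laplace_v.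
by apply: cvgM; [exact: cvg_cst|apply: laplace_v].
Qed.



Unset Implicit Arguments.
Let ZZ n := dotv (Z n) (Z n).
Let ZM n w := dotv (Z n) (fun i => M n i w).
Let ZR n w := dotv (Z n) (fun i => Rv n i w).
Let MM n w := dotv (fun i => M n i w) (fun i => M n i w).
Let MR n w := dotv (fun i => M n i w) (fun i => Rv n i w).
Let X n w : R * R := (Num.sqrt n%:R * (ZR n w / ZZ n - (C + A * B)),
  Num.sqrt n%:R * ((MM n w * ZR n w - ZM n w * MR n w) / (ZZ n * MM n w - ZM n w ^+ 2)
    + dl * s2 * ZM n w / (s1 * ZZ n) - C)).
Let ze n w := dotv (Z n) (fun i => E1 n i w).
Let ee n w := dotv (fun i => E1 n i w) (fun i => E1 n i w).
(** The coefficient of the residual [W n i] in t1 X.1 + t2 X.2, as a function of the first errors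
    [e]. *)
Let beta (t1 t2 : R) n (e : 'I_n -> R) i :=
  Num.sqrt n%:R * t1 / ZZ n * Z n i + Num.sqrt n%:R * t2 * ols_coef A (Z n) e i.
(** The coefficient of Z.E1 in the same combination. *)
Let slope (t1 t2 : R) n := Num.sqrt n%:R * (t1 * (B + rho) + t2 * rho) / ZZ n.
Set Implicit Arguments.

Let mX n : measurable_fun setT (X n).
Proof.
have mM i : measurable_fun setT (M n i).
  rewrite (_ : M n i = fun w => Z n i * A + E1 n i w); last exact/funext/HM.
  by apply: measurable_funD => //; exact: measurable_cst.
have mR i : measurable_fun setT (Rv n i).
  rewrite (_ : Rv n i = fun w => Z n i * C + M n i w * B + E2 n i w); last exact/funext/HR.
  apply: measurable_funD => //; apply: measurable_funD; first exact: measurable_cst.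
  by apply: measurable_funM => //; exact: measurable_cst.
have mz i : measurable_fun setT (fun w : T => Z n i) by exact: measurable_cst.
have mZM : measurable_fun setT (ZM n) by exact: measurable_dotv mz mM.
have mZR : measurable_fun setT (ZR n) by exact: measurable_dotv mz mR.
have mMM : measurable_fun setT (MM n) by apply: measurable_dotv.
have mMR : measurable_fun setT (MR n) by exact: measurable_dotv mM mR.
have mc (c : R) : measurable_fun setT (fun w : T => c) by exact: measurable_cst.
apply: measurable_fun_pair; apply: measurable_funZ.
  by apply: measurable_funB => //; exact: measurable_funM.
apply: measurable_funB => //; apply: measurable_funD.
  apply: measurable_funM.
    by apply: measurable_funB; exact: measurable_funM.
  apply: measurable_funV; apply: measurable_funB; first exact: measurable_funZ.
  exact: measurable_funX.
by apply: measurable_funM => //; exact: measurable_funZ.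
Qed.

Let linear_X t1 t2 n w : ZZ n != 0 -> ZZ n * ee n w - ze n w ^+ 2 != 0 ->
  t1 * (X n w).1 + t2 * (X n w).2 =
  \sum_(i < n) beta t1 t2 n (fun i => E1 n i w) i * W n i w + slope t1 t2 n * ze n w.
Proof.
move=> z0 D0.
have EM : (fun i => M n i w) = (fun i => Z n i * A + E1 n i w).
  by apply/funext => i; exact: HM.
have ER : (fun i => Rv n i w) = (fun i => Z n i * C + (Z n i * A + E1 n i w) * B +
    (rho * E1 n i w + W n i w)).
  by apply/funext => i; rewrite HR HM /W; ring.
have s1n : s1 != 0 by rewrite gt_eqF.
have X1 : (X n w).1 = Num.sqrt n%:R *
    (((B + rho) * ze n w + dotv (Z n) (fun i => W n i w)) / ZZ n).
  by rewrite /X /ZR /= ER total_effect_error.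
have X2 : (X n w).2 = Num.sqrt n%:R *
    (\sum_(i < n) ols_coef A (Z n) (fun i => E1 n i w) i * W n i w + rho * ze n w / ZZ n).
  rewrite /X /ZR /MR /ZM /MM /= ER EM -(direct_effect_error A rho B C (fun i => W n i w) D0 z0); congr (_ * (_ + _ - _)).
  by rewrite /rho -/(ZZ n); field; rewrite z0 s1n.
have -> : \sum_(i < n) beta t1 t2 n (fun i => E1 n i w) i * W n i w =
    Num.sqrt n%:R * t1 / ZZ n * dotv (Z n) (fun i => W n i w) + Num.sqrt n%:R * t2 *
    (\sum_(i < n) ols_coef A (Z n) (fun i => E1 n i w) i * W n i w).
  by rewrite /dotv !mulr_sumr -big_split; apply: eq_bigr => i _; rewrite /beta [RHS]/=; ring.
by rewrite X1 X2 /slope; field.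
Qed.


(* Given the first errors, the residuals remain independent normal variables. *)
Let conditional_cf t1 t2 (c a : R) n :
  \int[P]_w cos (\sum_(i < n) beta t1 t2 n (fun i => E1 n i w) i * W n i w + (c * ze n w + a)) =
  \int[P]_w (expR (- (tau2 / 2 * \sum_(i < n) beta t1 t2 n (fun i => E1 n i w) i ^+ 2)) *
    cos (c * ze n w + a)).
Proof.
pose F (p : n.-tuple R * n.-tuple R) := cos (\sum_(i < n)
  beta t1 t2 n (fun i => tnth p.1 i) i * tnth p.2 i
  + (c * dotv (Z n) (fun i => tnth p.1 i) + a)).
have m1 i : measurable_fun setT (fun p : n.-tuple R * n.-tuple R => tnth p.1 i).
  exact: (measurableT_comp (measurable_tnth i) measurable_fst).
have m2 i : measurable_fun setT (fun p : n.-tuple R * n.-tuple R => tnth p.2 i).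
  exact: (measurableT_comp (measurable_tnth i) measurable_snd).
have mz i : measurable_fun setT (fun p : n.-tuple R * n.-tuple R => Z n i).
  exact: measurable_cst.
have mb i : measurable_fun setT (fun p : n.-tuple R * n.-tuple R =>
    beta t1 t2 n (fun i => tnth p.1 i) i).
  apply: measurable_funD; first exact: measurable_cst.
  by apply: measurable_funZ; exact: measurable_ols_coef.
have bF : bmeas F.
  apply: bmeas_cos; apply: measurable_funD.
    by apply: measurable_sum => i; exact: measurable_funM.
  apply: measurable_funD; last exact: measurable_cst.
  by apply: measurable_funZ; exact: measurable_dotv.
have mtE : measurable_fun setT (tup (E1 n)) by exact: measurable_tup.
have mtW : measurable_fun setT (tup (W n)) by exact: measurable_tup.
have iEW : indep P (tup (E1 n)) (tup (W n)).
  exact: (bvn_tup_indep s10 s20 dl1 dl2 (HE n)).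
have tE w : (fun i => tnth (tup (E1 n) w) i) = (fun i => E1 n i w).
  by apply/funext => i; rewrite tnth_mktuple.
have := indep_Rintegral mtE mtW iEW bF.
rewrite (_ : \int[P]_w _ = \int[P]_w cos (\sum_(i < n)
    beta t1 t2 n (fun i => E1 n i w) i * W n i w + (c * ze n w + a))); last first.
  apply: eq_Rintegral => w _; rewrite /F /= tE; congr (cos (_ + _)).
  by apply: eq_bigr => i _; rewrite tnth_mktuple.
move=> ->; apply: eq_Rintegral => w _.
have := cf_sum (bvn_second_mutually_indep s10 s20 dl1 dl2 (HE n))
  (bvn_second_cf s10 s20 dl1 dl2 (HE n)) (beta t1 t2 n (fun i => E1 n i w)) (c * ze n w + a).
rewrite (_ : \sum_(i < n) _ = tau2 / 2 * \sum_(i < n) beta t1 t2 n (fun i => E1 n i w) i ^+ 2).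
  move=> <-; apply: eq_Rintegral => w' _; rewrite /F /= tE; congr (cos (_ + _)).
  by apply: eq_bigr => i _; rewrite tnth_mktuple.
by rewrite mulr_sumr; apply: eq_bigr => i _; rewrite -/tau2; ring.
Qed.

(** Times [tau2], this is the variance of the residual part given the first errors. The factors sqrt
    n combine with the inner products so that only the averages [zn], [un], [vn] remain. *)
Let beta_sqr t1 t2 n w : (0 < n)%N -> ZZ n != 0 -> ZZ n * ee n w - ze n w ^+ 2 != 0 ->
  \sum_(i < n) beta t1 t2 n (fun i => E1 n i w) i ^+ 2 =
  (t1 ^+ 2 + 2 * t1 * t2) / zn n
   + t2 ^+ 2 * (A ^+ 2 * zn n + 2 * A * un n w + vn n w) / (zn n * vn n w - un n w ^+ 2).
Proof.
move=> n0 z0 D0; have nr0 : (n%:R : R) != 0 by rewrite pnatr_eq0 -lt0n.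
rewrite /beta (ols_coef_sum_sqr A _ _ D0 z0) -/(ZZ n) -/(ze n w) -/(ee n w).
rewrite /zn /un /vn -/(ZZ n) -/(ze n w) -/(ee n w).
have r2 : Num.sqrt n%:R ^+ 2 = n%:R :> R by rewrite sqr_sqrtr.
rewrite (_ : (Num.sqrt n%:R * t1 / ZZ n) ^+ 2 = n%:R * t1 ^+ 2 / ZZ n ^+ 2); last first.
  by rewrite !exprMn exprVn r2.
rewrite (_ : 2 * (Num.sqrt n%:R * t1 / ZZ n) * (Num.sqrt n%:R * t2) =
    Num.sqrt n%:R ^+ 2 * (2 * t1 * t2 / ZZ n)); last by field.
rewrite r2.
rewrite (_ : (Num.sqrt n%:R * t2) ^+ 2 = n%:R * t2 ^+ 2); last by rewrite exprMn r2.
rewrite (_ : ZZ n / n%:R * (ee n w / n%:R) - (ze n w / n%:R) ^+ 2 =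
  (ZZ n * ee n w - ze n w ^+ 2) / n%:R ^+ 2); last by field.
move: (ZZ n * ee n w - ze n w ^+ 2) D0 => D D0.
by field; rewrite nr0 z0 D0.
Qed.

(** The conditional characteristic function of the residual part, evaluated at the limits [q], 0 and
    s1^2 of the three averages. *)
Let cf_limit (t1 t2 : R) : R :=
  expR (- (tau2 / 2 * ((t1 ^+ 2 + 2 * t1 * t2) / q
    + t2 ^+ 2 * (A ^+ 2 * q + s1 ^+ 2) / (q * s1 ^+ 2)))).

Let cvg_cf_main (t1 t2 a : R) :
  \int[P]_w cos (slope t1 t2 n * ze n w + a) @[n --> \oo] -->
  expR (- ((t1 * (B + rho) + t2 * rho) ^+ 2 * s1 ^+ 2 / (2 * q))) * cos a.
Proof.
have zpos : \forall n \near \oo, 0 < zn n by exact: (cvgr_gt _ cvgZ).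
set k := t1 * (B + rho) + t2 * rho.
have H : expR (- (k ^+ 2 * s1 ^+ 2 / 2 * (zn n)^-1)) * cos a @[n --> \oo] -->
    expR (- (k ^+ 2 * s1 ^+ 2 / (2 * q))) * cos a.
  apply: cvgM; last exact: cvg_cst.
  apply: cvg_expR_comp; apply: cvgN.
  rewrite [X in _ --> X](_ : _ = k ^+ 2 * s1 ^+ 2 / 2 / q); last by field; rewrite gt_eqF.
  by apply: cvgM; [exact: cvg_cst|apply: cvgV; [rewrite gt_eqF|exact: cvgZ]].
apply: cvg_trans H; apply: near_eq_cvg; near=> n.
have n0 : (0 < n)%N by near: n; exact: nbhs_infty_gt.
have z0 : 0 < zn n by near: n.
have nr0 : 0 < n%:R :> R by rewrite ltr0n.
have ZZ0 : ZZ n != 0.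
  by apply: contraTneq z0 => h; rewrite /zn -/(ZZ n) h mul0r ltxx.
rewrite /ze cf_linear; congr (expR (- _) * _).
rewrite /slope -/k -/(ZZ n) /zn -/(ZZ n) !exprMn exprVn sqr_sqrtr ?(ltW nr0)//.
by field; rewrite ZZ0 gt_eqF.
Unshelve. all: end_near. Qed.

Lemma cvg_mediation_cf (t1 t2 a : R) :
  \int[P]_w cos (t1 * (X n w).1 + t2 * (X n w).2 + a) @[n --> \oo] -->
  cf_limit t1 t2 *
    (expR (- ((t1 * (B + rho) + t2 * rho) ^+ 2 * s1 ^+ 2 / (2 * q))) * cos a).
Proof.
pose J n := \int[P]_w cos (slope t1 t2 n * ze n w + a).
have cJ : cf_limit t1 t2 * J n @[n --> \oo] --> cf_limit t1 t2 *
    (expR (- ((t1 * (B + rho) + t2 * rho) ^+ 2 * s1 ^+ 2 / (2 * q))) * cos a).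
  by apply: cvgM; [exact: cvg_cst|exact: cvg_cf_main].
apply/cvgrPdist_le => e e0.
have e4 : 0 < e / 4 by rewrite divr_gt0.
have s12 : 0 < s1 ^+ 2 by rewrite exprn_gt0.
have [dt dt0 Hdt] := conditional_cf_near tau2 A t1 t2 q0 s12 e4.
have [c c0 Hc] := deviation_lower_bound (s1 ^+ 2) dt0.
(* On the bad event cosines differ by at most 2 <= 2 dev / c, which costs 2 e / 16 in expectation,
   within one share e / 4. *)
have ce : 0 < c * (e / 16) by rewrite mulr_gt0// divr_gt0.
have /cvgrPdist_le/(_ _ ce) Hdev := cvg_dev.
have /cvgrPdist_le/(_ _ e4) HJ := cJ.
have /cvgrPdist_lt/(_ _ dt0) Hz := cvgZ.
have zpos : \forall n \near \oo, 0 < zn n by exact: (cvgr_gt _ cvgZ).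
near=> n.
have n0 : (0 < n)%N by near: n; exact: nbhs_infty_gt.
have nr0 : 0 < n%:R :> R by rewrite ltr0n.
have z0 : 0 < zn n by near: n.
have zq : `|zn n - q| < dt by rewrite distrC; near: n.
have hJ : `|cf_limit t1 t2 * (expR (- ((t1 * (B + rho) + t2 * rho) ^+ 2 * s1 ^+ 2 / (2 * q)))
    * cos a) - cf_limit t1 t2 * J n| <= e / 4 by near: n.
have hdev : \int[P]_w dev n w <= c * (e / 16).
  have : `|0 - \int[P]_w dev n w| <= c * (e / 16) by near: n.
  by rewrite sub0r normrN; apply: le_trans; exact: ler_norm.
have ZZ0 : ZZ n != 0.
  by apply: contraTneq z0 => h; rewrite /zn -/(ZZ n) h mul0r ltxx.
pose G w := expR (- (tau2 / 2 * \sum_(i < n) beta t1 t2 n (fun i => E1 n i w) i ^+ 2)).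
(* [S] agrees with the linear form of the estimation errors when the design is nonsingular and is
   affine in the residuals everywhere, so conditioning on the first errors applies to it without
   restriction to an event. *)
pose S w := \sum_(i < n) beta t1 t2 n (fun i => E1 n i w) i * W n i w
  + (slope t1 t2 n * ze n w + a).
have dev0 w : 0 <= dev n w.
  by rewrite addr_ge0 ?sqr_ge0// le_min ler01 normr_ge0.
have cd0 w : 0 <= c^-1 * dev n w by rewrite mulr_ge0// invr_ge0 ltW.
(* Either an average is far from its limit and dev >= c, or the determinant is positive and both the
   conditional characteristic function and the linear form are under control. *)
have split_dev w : (1 <= c^-1 * dev n w) \/
    [/\ 0 < zn n * vn n w - un n w ^+ 2 & `|G w - cf_limit t1 t2| <= e / 4 /\
     cos (t1 * (X n w).1 + t2 * (X n w).2 + a) = cos (S w)].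
  have [hu|hu] := leP dt `|un n w|.
    by left; rewrite ler_pdivlMl// mulr1; apply: Hc; left.
  have [hv|hv] := leP dt `|vn n w - s1 ^+ 2|.
    by left; rewrite ler_pdivlMl// mulr1; apply: Hc; right.
  right; have [hD hG] := Hdt _ _ _ zq hu hv.
  have D0 : ZZ n * ee n w - ze n w ^+ 2 != 0.
    apply: contraTneq hD => h; rewrite -leNgt.
    have -> : zn n * vn n w - un n w ^+ 2 = (ZZ n * ee n w - ze n w ^+ 2) / n%:R ^+ 2.
      rewrite /zn /vn /un -/(ZZ n) -/(ee n w) -/(ze n w); field.
      by rewrite gt_eqF.
    by rewrite h mul0r.
  split=> //; split; first by rewrite /G beta_sqr.
  by rewrite /S linear_X// addrA.
have mE i : measurable_fun setT (E1 n i) by [].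
have mze : measurable_fun setT (ze n).
  by apply: measurable_dotv => // i; exact: measurable_cst.
have mb i : measurable_fun setT (fun w => beta t1 t2 n (fun i => E1 n i w) i).
  apply: measurable_funD; first exact: measurable_cst.
  by apply: measurable_funZ; exact: measurable_ols_coef.
have msl : measurable_fun setT (fun w => slope t1 t2 n * ze n w + a).
  by apply: measurable_funD; [exact: measurable_funZ|exact: measurable_cst].
have bS : bmeas (fun w => cos (S w)).
  apply: bmeas_cos; apply: measurable_funD => //.
  by apply: measurable_sum => i; exact: measurable_funM.
have mX1 : measurable_fun setT (fun w => (X n w).1).
  exact: (measurableT_comp measurable_fst (mX n)).
have mX2 : measurable_fun setT (fun w => (X n w).2).
  exact: (measurableT_comp measurable_snd (mX n)).
have bX : bmeas (fun w => cos (t1 * (X n w).1 + t2 * (X n w).2 + a)).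
  apply: bmeas_cos; apply: measurable_funD; last exact: measurable_cst.
  exact: (measurable_funD (measurable_funZ t1 mX1) (measurable_funZ t2 mX2)).
have tau20 : 0 < tau2 by exact: tau2_gt0.
have t20 : 0 <= tau2 / 2 by rewrite divr_ge0// ltW.
have G01 w : 0 <= tau2 / 2 * \sum_(i < n) beta t1 t2 n (fun i => E1 n i w) i ^+ 2.
  by rewrite mulr_ge0// sumr_ge0// => i _; rewrite sqr_ge0.
have bG : bmeas G.
  apply: bmeas_expRN => //; apply: measurable_funZ; apply: measurable_sum => i.
  exact: measurable_funX.
have bcs : bmeas (fun w => cos (slope t1 t2 n * ze n w + a)) by exact: bmeas_cos.
have bd := bmeas_dev n.
have bcd : bmeas (fun w => c^-1 * dev n w) by exact: (bmeasM (bmeas_cst _) bd).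
have Icd : \int[P]_w (c^-1 * dev n w) <= e / 16.
  by rewrite RintE_Z// ler_pdivrMl.
have cf1 : 0 <= cf_limit t1 t2 <= 1.
  rewrite expR_ge0/= -[leRHS]expR0 ler_expR oppr_le0 mulr_ge0//.
  (* The term t2^2 / q hidden in the second fraction completes the square, since t1^2 + 2 t1 t2
     alone has no sign. *)
  have -> : (t1 ^+ 2 + 2 * t1 * t2) / q + t2 ^+ 2 * (A ^+ 2 * q + s1 ^+ 2) / (q * s1 ^+ 2) =
     (t1 + t2) ^+ 2 / q + (t2 * A) ^+ 2 / s1 ^+ 2 by field; rewrite !gt_eqF.
  by rewrite addr_ge0// divr_ge0 ?sqr_ge0// ltW.
have h1 : `|\int[P]_w cos (t1 * (X n w).1 + t2 * (X n w).2 + a) - \int[P]_w cos (S w)| <= e / 4.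
  have b2 : bmeas (fun w => 2 * (c^-1 * dev n w)) by exact: (bmeasM (bmeas_cst _) bcd).
  apply: (le_trans (RintE_dist_le P bX bS b2 _)) => [w|].
    case: (split_dev w) => [h|[_ [_ ->]]]; last by rewrite subrr normr0 mulr_ge0.
    rewrite (le_trans (ler_normB _ _))// (@le_trans _ _ (1 + 1))//.
      by rewrite lerD ?cos_max.
    by move: h; lra.
  by rewrite RintE_Z//; move: Icd; lra.
have h2 : `|\int[P]_w cos (S w) - cf_limit t1 t2 * J n| <= e / 4 + e / 4.
  rewrite /S conditional_cf -/G /J -RintE_Z//.
  have b3 : bmeas (fun w => e / 4 + 2 * (c^-1 * dev n w)).
    exact: (bmeasD (bmeas_cst _) (bmeasM (bmeas_cst _) bcd)).
  have b4 : bmeas (fun w => cf_limit t1 t2 * cos (slope t1 t2 n * ze n w + a)).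
    exact: (bmeasM (bmeas_cst _) bcs).
  apply: (le_trans (RintE_dist_le P (bmeasM bG bcs) b4 b3 _)) => [w|].
    rewrite -mulrBl normrM (@le_trans _ _ `|G w - cf_limit t1 t2|)//.
      by rewrite ler_piMr// cos_max.
    case: (split_dev w) => [h|[_ [h _]]]; last by rewrite (le_trans h)// lerDl mulr_ge0.
    have /andP[cf_0 cf_1] := cf1.
    rewrite (@le_trans _ _ 1)//; last by move: h e4; lra.
    have G0 : 0 <= G w by exact: expR_ge0.
    have G1 : G w <= 1 by rewrite -[leRHS]expR0 ler_expR oppr_le0.
    by rewrite ler_norml; move: cf_0 cf_1 G0 G1; lra.
  rewrite RintE_D; [|exact: bmeas_cst|exact: (bmeasM (bmeas_cst _) bcd)].
  by rewrite RintE_cst RintE_Z//; move: Icd e4; lra.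
set L := cf_limit t1 t2 * (_ * _) in hJ *.
set I1 := \int[P]_w cos (t1 * _ + _ + a) in h1 *.
set I2 := \int[P]_w cos (S w) in h1 h2.
(* Three errors: convergence of the part in Z.E1, replacement of the conditional factor by its
   limit, replacement of the estimators by [S]; they cost e / 4, e / 2 and e / 4. *)
rewrite (_ : L - I1 = (L - cf_limit t1 t2 * J n) - (I2 - cf_limit t1 t2 * J n) - (I1 - I2));
  last by ring.
rewrite (le_trans (ler_normB _ _))// (@le_trans _ _ (e / 4 + (e / 4 + e / 4) + e / 4))//.
  by rewrite lerD// (le_trans (ler_normB _ _))// lerD.
by rewrite le_eqVlt; apply/orP; left; apply/eqP; field.
Unshelve. all: end_near. Qed.

Let v11 := (B ^+ 2 * s1 ^+ 2 + 2 * B * dl * s1 * s2 + s2 ^+ 2) / q.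
Let v12 := (s2 ^+ 2 + B * dl * s1 * s2) / q.
Let v22 := s2 ^+ 2 * (q * A ^+ 2 + s1 ^+ 2 - q * A ^+ 2 * dl ^+ 2) / (q * s1 ^+ 2).

(** The limit variance splits into the contribution of Z.E1 and that of the residuals, matching the
    two factors of the limit characteristic function; nonnegativity is visible in this form. *)
Let qform2_limit t1 t2 : qform2 v11 v12 v22 t1 t2 =
  (t1 * (B + rho) + t2 * rho) ^+ 2 * s1 ^+ 2 / q +
  tau2 * ((t1 + t2) ^+ 2 / q + (t2 * A) ^+ 2 / s1 ^+ 2).
Proof.
by rewrite /qform2 /v11 /v12 /v22 /rho /tau2; field; rewrite !gt_eqF.
Qed.

Lemma mediation_clt : exists mu : probability (R * R)%type R,
  is_gauss2 mu v11 v12 v22 /\ cvg_distr P X mu.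
Proof.
have tau20 : 0 < tau2 by exact: tau2_gt0.
have s1n : s1 != 0 by rewrite gt_eqF.
have qn : q != 0 by rewrite gt_eqF.
have q2 t1 t2 : 0 <= qform2 v11 v12 v22 t1 t2.
  rewrite qform2_limit addr_ge0//.
    by rewrite divr_ge0 ?(ltW q0)// mulr_ge0 ?sqr_ge0.
  by rewrite mulr_ge0 ?(ltW tau20)// addr_ge0// divr_ge0 ?sqr_ge0// ltW.
have v110 : 0 < v11.
  have -> : v11 = ((B + rho) ^+ 2 * s1 ^+ 2 + tau2) / q.
    by rewrite /v11 /rho /tau2; field; rewrite qn s1n.
  by rewrite divr_gt0// ltr_wpDl// mulr_ge0 ?sqr_ge0.
have hv : v12 ^+ 2 <= v11 * v22.
  rewrite -subr_ge0.
  (* The determinant of the limit covariance, written as a visibly nonnegative quantity for the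
     Cholesky factorisation. *)
  have -> : v11 * v22 - v12 ^+ 2 = tau2 * ((B * s1 / q) ^+ 2 + v11 * (A / s1) ^+ 2).
    by rewrite /v11 /v12 /v22 /tau2; field; rewrite qn s1n.
  rewrite mulr_ge0 ?(ltW tau20)// addr_ge0 ?sqr_ge0//.
  by rewrite mulr_ge0 ?sqr_ge0// ltW.
(* The sample of size 1 supplies one pair of errors on [T]. Only the law of [V] matters; its
   relation to the sequence [X] is irrelevant to convergence in distribution. *)
have [V mV HV] := gauss2_realisation s10 s20 dl1 dl2 (HE 1%N) v110 hv.
exists (law P mV); split; first exact: HV.
move=> f cf bf.
have mV1 : measurable_fun setT (fun w => (V w).1).
  exact: (measurableT_comp measurable_fst mV).
have mV2 : measurable_fun setT (fun w => (V w).2).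
  exact: (measurableT_comp measurable_snd mV).
have HV' : is_gauss2 (fun S => P ((fun w => ((V w).1, (V w).2)) @^-1` S)) v11 v12 v22.
  by move=> t1 t2 D mD; exact: HV.
have H (a b c : R) : \int[P]_w cos (a * (X n w).1 + b * (X n w).2 + c) @[n --> \oo] -->
    \int[P]_w cos (a * (V w).1 + b * (V w).2 + c).
  rewrite (bvn_cf mV1 mV2 q2 HV').
  rewrite [X in _ --> X](_ : _ = cf_limit a b *
    (expR (- ((a * (B + rho) + b * rho) ^+ 2 * s1 ^+ 2 / (2 * q))) * cos c)).
    exact: cvg_mediation_cf.
  rewrite mulrA /cf_limit -expRD qform2_limit; congr (expR _ * _).
  by field; rewrite qn s1n.
have bmf : bmeas f by split => //; exact: continuous_measurable_plane.
have := levy_plane (P := P) (P' := P) mX mV H cf bf.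
rewrite -(Rintegral_law P mV bmf) => L.
rewrite (EFin_RintE (law P mV) bmf).
rewrite [X in X @ _ --> _](_ : _ = fun n => (\int[P]_w f (X n w))%:E); last first.
  by apply/funext => n; rewrite (EFin_RintE P (bmeas_comp (mX n) bmf)).
by apply: cvg_EFin; [exact: nearW|exact: L].
Qed.

End Mediation.

Unset Implicit Arguments.

Theorem theorem3 (R : realType) (d : measure_display) (T : measurableType d)
  (P : probability T R)
  (Z : forall n : nat, 'I_n -> R)
  (E1 E2 M Rv : forall n : nat, 'I_n -> T -> R)
  (A B C s1 s2 dl q : R) :
  0 < s1 -> 0 < s2 -> -1 < dl -> dl < 1 -> 0 < q ->
  (fun n : nat => dotv (Z n) (Z n) / n%:R) @ \oo --> q ->
  (forall n, iid_bvn P (E1 n) (E2 n) s1 s2 dl) ->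
  (forall n i w, M n i w = Z n i * A + E1 n i w) ->
  (forall n i w, Rv n i w = Z n i * C + M n i w * B + E2 n i w) ->
  let ZZ n := dotv (Z n) (Z n) in
  let ZM n w := dotv (Z n) (fun i => M n i w) in
  let ZR n w := dotv (Z n) (fun i => Rv n i w) in
  let MM n w := dotv (fun i => M n i w) (fun i => M n i w) in
  let MR n w := dotv (fun i => M n i w) (fun i => Rv n i w) in
  let hatC' n w := ZR n w / ZZ n in
  let hatC n w := (MM n w * ZR n w - ZM n w * MR n w)
                    / (ZZ n * MM n w - ZM n w ^+ 2)
                  + dl * s2 * ZM n w / (s1 * ZZ n) in
  let Xn n w := (Num.sqrt n%:R * (hatC' n w - (C + A * B)),
                 Num.sqrt n%:R * (hatC n w - C)) in
  exists mu : probability (R * R)%type R,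
    is_gauss2 mu
      ((B ^+ 2 * s1 ^+ 2 + 2 * B * dl * s1 * s2 + s2 ^+ 2) / q)
      ((s2 ^+ 2 + B * dl * s1 * s2) / q)
      (s2 ^+ 2 * (q * A ^+ 2 + s1 ^+ 2 - q * A ^+ 2 * dl ^+ 2) / (q * s1 ^+ 2))
    /\ cvg_distr P Xn mu.
Proof.
move=> s10 s20 dl1 dl2 q0 cvgZ HE HM HR ZZ ZM ZR MM MR hatC' hatC Xn.
exact: (mediation_clt s10 s20 dl1 dl2 q0 cvgZ HE HM HR).
Qed.
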